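(* Let $(\mathcal M,\langle\cdot,\cdot\rangle,J)$ be one of the $2n$-dimensional pseudo-Riemannian complex space forms $\mathbb{CP}^n_{p,c}$ or para-complex space forms $\mathbb{DP}^n$, $\overline{\mathbb{DP}^n}$ (with holomorphic or para-holomorphic curvature $4c$, $c=\pm1$). Then there exists no real hypersurface of $\mathcal M$ (with non-degenerate induced metric) which is umbilic, and there exists no real hypersurface of $\mathcal M$ (with non-degenerate induced metric) whose shape operator is parallel.
   Context: Ambient spaces. Let $c\in\{1,-1\}$ and $\varepsilon\in\{1,-1\}$; $\varepsilon=1$ is the complex case and $\varepsilon=-1$ the para-complex case. Complex case ($\varepsilon=1$): on $\mathbb C^{n+1}$ take the metric $\langle\cdot,\cdot\rangle_{2p}=\mathrm{Re}\big(-\sum_{j=1}^p dz_j\,d\bar z_j+\sum_{j=p+1}^{n+1}dz_j\,d\bar z_j\big)$. The space $\mathbb{CP}^n_{p,c}$ is the quotient of the (non-empty) hyperquadric $\{z\in\mathbb C^{n+1}:\langle z,z\rangle_{2p}=c\}$ by the action of unit complex numbers, with the metric making the projection a pseudo-Riemannian submersion and the complex structure $J$ induced by multiplication by $i$. Para-complex case ($\varepsilon=-1$): the para-complex numbers $\mathbb D$ are $\mathbb R^2$ with product $(x,y)(x',y')=(xx'+yy',xy'+x'y)$. On $\mathbb D^{n+1}$ take the metric $\langle\cdot,\cdot\rangle_*=\sum_{j=1}^{n+1}(dx_j^2-dy_j^2)$. For $c=1$, $\mathbb{DP}^n$ is the quotient of $\{z\in\mathbb D^{n+1}:\langle z,z\rangle_*=-1\}$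 by the action $z\mapsto(\cosh\theta,\sinh\theta)\,z$, $\theta\in\mathbb R$; for $c=-1$, $\overline{\mathbb{DP}^n}$ is the quotient of $\{z:\langle z,z\rangle_*=1\}$ by the same action. Both carry the metric making the projection a pseudo-Riemannian submersion and the para-complex structure $J$ induced by multiplication by $(0,1)$. In all cases $J^2=-\varepsilon\,\mathrm{Id}$, $\langle J\cdot,J\cdot\rangle=\varepsilon\langle\cdot,\cdot\rangle$, $J$ is parallel, and the curvature is $R(X,Y)=c\,(\varepsilon X\wedge Y+JX\wedge JY+2\langle X,JY\rangle J)$, where $(X\wedge Y)Z=\langle Y,Z\rangle X-\langle X,Z\rangle Y$. Hypersurfaces. A real hypersurface $\mathcal S$ is an immersed submanifold of real codimension 1; it is non-degenerate if its induced metric is non-degenerate. It then has locally a unit normal field $N$ ($\langle N,N\rangle=\pm1$), and its shape operator $A$ is defined by $\nabla_XN=-AX$ for $X$ tangent to $\mathcal S$, where $\nabla$ is the Levi-Civita connection of $\mathcal M$. The hypersurface is umbilic if $A=\lambda\,\mathrm{Id}$ for some smooth function $\lambda$ on $\mathcal S$; it has parallel shape operator if $(\overline\nabla_XA)Y=0$ for all tangent $X,Y$, where $\overline\nabla$ is the Levi-Civita connection of $\mathcal S$.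
   Formalization: The formal theorem assumes n ≥ 2: for n = 1 a real hypersurface is a curve, its shape operator is 1×1, so every non-degenerate curve is umbilic and geodesics have parallel shape operator, and the claim fails. Hypersurfaces are taken to be non-empty. *)

(* Defs.v *)
From HB Require Import structures.
From mathcomp Require Export all_boot all_order all_algebra.
From mathcomp Require Export all_classical all_reals all_analysis.
Export Order.TTheory GRing.Theory Num.Theory numFieldNormedType.Exports.

Set Implicit Arguments.
Unset Strict Implicit.
Unset Printing Implicit Defensive.

Local Open Scope classical_set_scope.
Local Open Scope ring_scope.

(* Tangent vectors of R^d are row vectors; an endomorphism field A : R^d -> 'M_d
   acts on the right, X |-> X *m A x, and the differential of f at x is
   X |-> 'D_X f x. *)
Section LocalGeometry.
Variable R : realType.

(* Derivatives in all directions rather than along a basis: on an open U this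
   is the usual class C^k. *)
Fixpoint Ck (V W : normedModType R) (k : nat) (U : set V) (f : V -> W) : Prop :=
  (forall x, U x -> {for x, continuous f}) /\
  (if k is k'.+1 then
     (forall x v, U x -> derivable f x v) /\ (forall v, Ck k' U ('D_v f))
   else True).

Definition smooth_on (V W : normedModType R) (U : set V) (f : V -> W) : Prop :=
  forall k, Ck k U f.

Definition e_ d (i : 'I_d) : 'rV[R]_d := delta_mx 0 i.

Definition dot d (B : 'M[R]_d) (u v : 'rV[R]_d) : R := (u *m B *m v^T) 0 0.

Definition christoffel d (g : 'rV[R]_d -> 'M[R]_d) (x : 'rV[R]_d)
    (i j k : 'I_d) : R :=
  2^-1 * \sum_l invmx (g x) k l *
    ('D_(e_ i) (fun y => g y j l) x + 'D_(e_ j) (fun y => g y i l) x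
     - 'D_(e_ l) (fun y => g y i j) x).

Definition Gamma d (g : 'rV[R]_d -> 'M[R]_d) (x u v : 'rV[R]_d) : 'rV[R]_d :=
  \row_k \sum_i \sum_j u 0 i * v 0 j * christoffel g x i j k.

(* The Levi-Civita connection of g, acting on a vector field Y along a map f:
   the derivative of Y in direction X. *)
Definition nabla_along m d (g : 'rV[R]_d -> 'M[R]_d)
    (f : 'rV[R]_m -> 'rV[R]_d) (Y : 'rV[R]_m -> 'rV[R]_d)
    (x X : 'rV[R]_m) : 'rV[R]_d :=
  'D_X Y x + Gamma g (f x) ('D_X f x) (Y x).

Definition nabla d (g : 'rV[R]_d -> 'M[R]_d)
    (X Y : 'rV[R]_d -> 'rV[R]_d) (x : 'rV[R]_d) : 'rV[R]_d :=
  nabla_along g id Y x (X x).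

Definition pullback m d (f : 'rV[R]_m -> 'rV[R]_d)
    (g : 'rV[R]_d -> 'M[R]_d) (x : 'rV[R]_m) : 'M[R]_m :=
  \matrix_(i, j) dot (g (f x)) ('D_(e_ i) f x) ('D_(e_ j) f x).

(* A local parametrization (U, phi) of a topological space T. *)
Definition is_param (T : topologicalType) d
    (p : set 'rV[R]_d * ('rV[R]_d -> T)) : Prop :=
  [/\ open p.1, set_inj p.1 p.2,
      forall x, p.1 x -> {for x, continuous p.2} &
      forall O, open O -> O `<=` p.1 -> open (p.2 @` O)].

Definition compatible (T : Type) d
    (p q : set 'rV[R]_d * ('rV[R]_d -> T)) : Prop :=
  exists2 t : 'rV[R]_d -> 'rV[R]_d,
    smooth_on (p.1 `&` p.2 @^-1` (q.2 @` q.1)) t &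
    forall x, p.1 x -> (q.2 @` q.1) (p.2 x) -> q.1 (t x) /\ q.2 (t x) = p.2 x.

(* A non-empty smooth manifold of dimension d. *)
Record manifold (d : nat) := Manifold {
  carrier :> topologicalType;
  atlas : set (set 'rV[R]_d * ('rV[R]_d -> carrier));
  manifold_nonempty : [set: carrier] !=set0;
  manifold_hausdorff : hausdorff_space carrier;
  manifold_countable : @second_countable carrier;
  atlas_param : forall p, atlas p -> is_param p;
  atlas_cover : forall s : carrier, exists2 p, atlas p & (p.2 @` p.1) s;
  atlas_compatible : forall p q, atlas p -> atlas q -> compatible p q }.

End LocalGeometry.

(* CP p b is CP^n_{p,c} with c = (-1)^b; DP is the para-complex projective space
   with c = 1, DPbar the one with c = -1. *)
Inductive space_form (n : nat) : Type :=
  | CP of 'I_n.+2 & bool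
  | DP
  | DPbar.
Arguments DP {n}.
Arguments DPbar {n}.

Section SpaceForm.
Variables (R : realType) (n : nat) (M : space_form n).

(* C^{n+1} or D^{n+1}; z = (x, y) stands for x + i y, resp. the vector of the
   para-complex numbers (x_j, y_j). *)
Definition Kspace : normedModType R := ('rV[R]_n.+1 * 'rV[R]_n.+1)%type.

Definition ip (z w : Kspace) : R :=
  match M with
  | CP p _ => \sum_(j < n.+1)
      (-1) ^+ (j < p)%N * (z.1 0 j * w.1 0 j + z.2 0 j * w.2 0 j)
  | _ => \sum_(j < n.+1) (z.1 0 j * w.1 0 j - z.2 0 j * w.2 0 j)
  end.

Definition level : R :=
  match M with CP _ b => (-1) ^+ b | DP => -1 | DPbar => 1 end.

Definition quadric : set Kspace := [set z | ip z z = level].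

(* Multiplication by i, resp. by (0, 1). *)
Definition Jmul (z : Kspace) : Kspace :=
  match M with CP _ _ => (- z.2, z.1) | _ => (z.2, z.1) end.

(* The coordinates of e^{i t}, resp. of (cosh t, sinh t). *)
Definition unit_coord (t : R) : R * R :=
  match M with
  | CP _ _ => (cos t, sin t)
  | _ => ((expR t + expR (- t)) / 2, (expR t - expR (- t)) / 2)
  end.

Definition act (t : R) (z : Kspace) : Kspace :=
  (unit_coord t).1 *: z + (unit_coord t).2 *: Jmul z.

Definition orbit (z : Kspace) : set Kspace := range (act ^~ z).

(* The points of the quotient of the quadric are the orbits. *)
Definition points : set (set Kspace) := orbit @` quadric.

(* The fibre of the projection through z is spanned, at z, by Jmul z. *)
Definition horizontal (z u : Kspace) : Kspace :=
  u - (ip u (Jmul z) / ip (Jmul z) (Jmul z)) *: Jmul z.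

(* Local parametrizations of the quotient manifold M, given by a smooth lift
   sigma to the quadric: orbit \o sigma is injective and its differential is
   injective, i.e. no nonzero vector is sent by the differential of sigma into
   the kernel of the differential of the projection.  These are the
   parametrizations, for the smooth structure making the projection a
   submersion, that lift to the quadric; their images cover the quotient. *)
Definition is_slice (V : set 'rV[R]_(n.*2)) (sigma : 'rV[R]_(n.*2) -> Kspace) :
    Prop :=
  [/\ open V, smooth_on V sigma, sigma @` V `<=` quadric,
      set_inj V (orbit \o sigma) &
      forall x v t, V x -> 'D_v sigma x = t *: Jmul (sigma x) -> v = 0].

(* The metric of M in the parametrization orbit \o sigma: the projection is an
   isometry on the orthogonal of the fibre. *)
Definition metric (sigma : 'rV[R]_(n.*2) -> Kspace) (x : 'rV[R]_(n.*2)) :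
    'M[R]_(n.*2) :=
  \matrix_(a, b) ip (horizontal (sigma x) ('D_(e_ R a) sigma x))
                    (horizontal (sigma x) ('D_(e_ R b) sigma x)).

Notation dimS := (n.*2).-1.

Section Patch.
Variables (S : manifold R dimS) (F : S -> set Kspace).

(* A coordinate representation of F : S -> M: f : dom -> sdom is F read in the
   parametrization par of S and the parametrization orbit \o sigma of M. *)
Record patch := Patch {
  dom : set 'rV[R]_dimS;
  par : 'rV[R]_dimS -> S;
  sdom : set 'rV[R]_(n.*2);
  sigma : 'rV[R]_(n.*2) -> Kspace;
  rep : 'rV[R]_dimS -> 'rV[R]_(n.*2);
  patch_open : open dom;
  patch_atlas : exists2 U, atlas (U, par) & dom `<=` U;
  patch_slice : is_slice sdom sigma;
  patch_smooth : smooth_on dom rep;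
  patch_sub : rep @` dom `<=` sdom;
  patch_eq : forall x, dom x -> F (par x) = orbit (sigma (rep x)) }.

Definition around (P : patch) (s : S) : Prop := (par P @` dom P) s.

Definition immersive (P : patch) : Prop :=
  forall x v, dom P x -> 'D_v (rep P) x = 0 -> v = 0.

Definition ambient (P : patch) : 'rV[R]_(n.*2) -> 'M[R]_(n.*2) :=
  metric (sigma P).

Definition induced (P : patch) : 'rV[R]_dimS -> 'M[R]_dimS :=
  pullback (rep P) (ambient P).

Definition unit_normal (P : patch) (N : 'rV[R]_dimS -> 'rV[R]_(n.*2)) : Prop :=
  smooth_on (dom P) N /\
  forall x, dom P x ->
    (dot (ambient P (rep P x)) (N x) (N x) = 1 \/
     dot (ambient P (rep P x)) (N x) (N x) = -1) /\
    forall X, dot (ambient P (rep P x)) (N x) ('D_X (rep P) x) = 0.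

Definition shape_operator (P : patch) (N : 'rV[R]_dimS -> 'rV[R]_(n.*2))
    (A : 'rV[R]_dimS -> 'M[R]_dimS) : Prop :=
  smooth_on (dom P) A /\
  forall x X, dom P x ->
    nabla_along (ambient P) (rep P) N x X = - 'D_(X *m A x) (rep P) x.

End Patch.

(* A real hypersurface of M: a manifold of dimension 2n - 1 smoothly immersed in
   M. *)
Record hypersurface := Hypersurface {
  source :> manifold R dimS;
  imm : source -> set Kspace;
  imm_points : forall s, points (imm s);
  imm_immersion : forall s : source,
    exists P : patch imm, around P s /\ immersive P }.

Definition nondegenerate (S : hypersurface) : Prop :=
  forall (P : patch (@imm S)) x, dom P x -> induced P x \in unitmx.

(* The unit normal field exists only locally, and up to sign, so that A and
   lambda are local objects, and the conditions below do not depend on the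
   choice of N. *)
Definition umbilic (S : hypersurface) : Prop :=
  forall s : S, exists (P : patch (@imm S)) N A,
    [/\ around P s, unit_normal P N, shape_operator P N A &
        exists2 lambda : 'rV[R]_dimS -> R, smooth_on (dom P) lambda &
          forall x, dom P x -> A x = (lambda x)%:M].

Definition parallel_shape (S : hypersurface) : Prop :=
  forall s : S, exists (P : patch (@imm S)) N A,
    [/\ around P s, unit_normal P N, shape_operator P N A &
        forall X Y, smooth_on (dom P) X -> smooth_on (dom P) Y ->
          forall x, dom P x ->
            nabla (induced P) X (fun y => Y y *m A y) x =
            nabla (induced P) X Y x *m A x].

End SpaceForm.

(* Main.v *)
From HB Require Import structures.
From mathcomp Require Import ring lra.
Require Import Defs.

(** Both conditions fix the Codazzi tensor of the shape operator [A]: the vector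
    (nabla_X A) Y - (nabla_Y A) X vanishes if [A] is parallel, and is
    X(lambda) Y - Y(lambda) X if [A] is lambda times the identity.  By the Codazzi
    equation it is the tangential part of the curvature R(X, Y) N, up to sign.
    Pair it with the tangent vector J N, and write omega(X, Y) for <X, J Y> and
    eta(X) for <X, J N>: what remains of the curvature is a nonzero multiple of
    omega, so that omega = alpha /\ eta on the hypersurface for a 1-form alpha
    (zero in the parallel case, a multiple of d lambda in the umbilic case).  Now
    J N is in the kernel of the restriction of omega, while eta(J N) = <J N, J N>
    is not 0.  Hence alpha is a multiple of eta, and omega is 0 on the
    hypersurface.  Then J maps the tangent space into the line of N, which is
    impossible in dimension 2n - 1 > 1 ([codazzi_indecomposable]).

    The Codazzi equation is proved without a curvature tensor, in the flat space
    that contains the quadric.  Let [s] be a map into the quadric, such as a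
    slice, or a slice read on the hypersurface.  Each partial derivative of [s] is
    the sum of a horizontal vector [hlift] and of [theta] times the vertical
    vector [J s].  The Christoffel symbols of the Gram matrix of the horizontal
    parts are given by the flat derivative corrected by [theta] ([covd],
    [christoffel_lower]): this covers both the metric of the space form and the
    induced one.  It follows that the horizontal lift of the unit normal has an
    explicit flat derivative ([weingarten]).  The second derivatives of that lift
    are symmetric ([schwarz]); paired with [J] times the lift, this symmetry is
    the Codazzi equation ([codazzi]).  The curvature enters through the exterior
    derivative of [theta], a multiple of omega ([der_theta_antisym]).

    The analysis behind this is that of functions of class C^k in the sense of
    directional derivatives: products and composites of smooth functions are
    smooth ([Ck_bilinear], [Ck_comp]), C^1 functions are differentiable
    ([C1_differentiable]), and second derivatives commute. *)

Set Implicit Arguments.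
Unset Strict Implicit.
Unset Printing Implicit Defensive.

Local Open Scope classical_set_scope.
Local Open Scope ring_scope.

(** * Maps of class C^k *)

Section ClassCk.
Variable R : realType.
Implicit Types V W : normedModType R.

Lemma near_open V W (U : set V) (f g : V -> W) x :
  open U -> {in U, f =1 g} -> U x -> \near x, f x = g x.
Proof.
move=> oU fg Ux; have : nbhs x U by exact: open_nbhs_nbhs.
by apply: filterS => y Uy; apply: fg; rewrite inE.
Qed.

Lemma derive_eq_on V W (U : set V) (f g : V -> W) x v :
  open U -> {in U, f =1 g} -> U x -> 'D_v f x = 'D_v g x.
Proof. by move=> oU fg Ux; apply: near_eq_derive; exact: near_open oU fg Ux. Qed.

Lemma derivable_eq_on V W (U : set V) (f g : V -> W) x v :
  open U -> {in U, f =1 g} -> U x -> derivable f x v -> derivable g x v.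
Proof. by move=> oU fg Ux; apply: near_eq_derivable; exact: near_open oU fg Ux. Qed.

Lemma continuous_eq_on V W (U : set V) (f g : V -> W) x :
  open U -> {in U, f =1 g} -> U x -> {for x, continuous f} ->
  {for x, continuous g}.
Proof.
move=> oU fg Ux cf; rewrite /prop_for /continuous_at.
have fgx : f x = g x by apply: fg; rewrite inE.
rewrite -fgx; apply: cvg_trans cf; apply: near_eq_cvg.
exact: near_open oU fg Ux.
Qed.

Lemma Ck_eq_on V W k (U : set V) (f g : V -> W) :
  open U -> {in U, f =1 g} -> Ck k U f -> Ck k U g.
Proof.
move=> oU; elim: k f g => [|k IH] f g fg /= [cf df].
  by split=> // x Ux; apply: (continuous_eq_on oU fg Ux); exact (cf x Ux).
split; first by move=> x Ux; apply: (continuous_eq_on oU fg Ux); exact (cf x Ux).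
case: df => df Cf; split=> [x v Ux|v].
  by apply: (derivable_eq_on oU fg Ux); exact (df x v Ux).
apply: IH (Cf v) => x; rewrite inE => Ux.
exact: derive_eq_on oU fg Ux.
Qed.

Lemma Ck_cont V W k (U : set V) (f : V -> W) x :
  Ck k U f -> U x -> {for x, continuous f}.
Proof. by case: k => [|k] [cf _] Ux; exact (cf x Ux). Qed.

Lemma Ck_derivable V W k (U : set V) (f : V -> W) x v :
  Ck k.+1 U f -> U x -> derivable f x v.
Proof. by move=> [_ [df _]] Ux; exact (df x v Ux). Qed.

Lemma Ck_derive V W k (U : set V) (f : V -> W) v :
  Ck k.+1 U f -> Ck k U ('D_v f).
Proof. by move=> [_ [_ Cf]]; exact (Cf v). Qed.

Lemma CkS V W k (U : set V) (f : V -> W) : Ck k.+1 U f -> Ck k U f.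
Proof.
elim: k f => [|k IH] f [cf [df Cf]]; first by split.
split; [exact cf|split; [exact df|by move=> v; exact (IH _ (Cf v))]].
Qed.

Lemma Ck_le V W j k (U : set V) (f : V -> W) :
  (j <= k)%N -> Ck k U f -> Ck j U f.
Proof.
elim: k => [|k IH]; first by rewrite leqn0 => /eqP ->.
by rewrite leq_eqVlt ltnS => /orP[/eqP -> //|jk] Cf; apply: IH jk (CkS Cf).
Qed.

Lemma Ck_cst V W k (U : set V) (w : W) : Ck k U (fun=> w).
Proof.
elim: k w => [|k IH] w; split=> //; try by move=> x _; exact: cst_continuous.
split=> [x v _|v]; first exact: derivable_cst.
have -> : 'D_v (fun=> w) = (fun=> 0 : W) :> (V -> W).
  by apply/funext => x; rewrite derive_cst.
exact: IH.
Qed.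

Lemma CkD V W k (U : set V) (f g : V -> W) : open U ->
  Ck k U f -> Ck k U g -> Ck k U (f + g).
Proof.
move=> oU; elim: k f g => [|k IH] f g [cf df] [cg dg].
  by split=> // x Ux; apply: continuousD; [exact (cf x Ux)|exact (cg x Ux)].
split; first by move=> x Ux; apply: continuousD; [exact (cf x Ux)|exact (cg x Ux)].
case: df => df Cf; case: dg => dg Cg; split=> [x v Ux|v].
  by apply: derivableD; [exact (df x v Ux)|exact (dg x v Ux)].
apply: Ck_eq_on oU _ (IH _ _ (Cf v) (Cg v)) => x; rewrite inE => Ux.
by rewrite deriveD //; [exact (df x v Ux)|exact (dg x v Ux)].
Qed.

Lemma Ck_sum V W k (U : set V) (I : Type) (r : seq I) (f : I -> V -> W) :
  open U -> (forall i, Ck k U (f i)) -> Ck k U (fun x => \sum_(i <- r) f i x).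
Proof.
move=> oU Cf; elim: r => [|i r IH].
  apply: Ck_eq_on oU _ (Ck_cst k U (0 : W)) => x _; by rewrite big_nil.
apply: Ck_eq_on oU _ (CkD oU (Cf i) IH) => x _.
by rewrite big_cons.
Qed.

(** One product rule then serves for scalar multiples, for products of functions
    and for the metric of the ambient space. *)
Definition cont_bilinear V1 V2 W (b : V1 -> V2 -> W) : Prop :=
  [/\ forall a u u' v, b (a *: u + u') v = a *: b u v + b u' v,
      forall a u v v', b u (a *: v + v') = a *: b u v + b u v' &
      continuous (fun p : V1 * V2 => b p.1 p.2)].

Lemma derivable_line V W (f : V -> W) x v :
  derivable f x v -> f (h *: v + x) @[h --> 0^'] --> f x.
Proof.
move=> df.
suff : {for 0, continuous (fun h : R => f (h *: v + x))}.
  by move=> /continuous_withinNx; rewrite scale0r add0r.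
exact/differentiable_continuous/derivable1_diffP/(derivable1P _ _ _).1.
Qed.

Lemma is_derive_bilinear V V1 V2 W (b : V1 -> V2 -> W) f g (x v : V) :
  cont_bilinear b -> derivable f x v -> derivable g x v ->
  is_derive x v (fun y => b (f y) (g y)) (b ('D_v f x) (g x) + b (f x) ('D_v g x)).
Proof.
move=> [bl br bc] df dg.
have bcc u w (F : R -> V1) (G : R -> V2) : F h @[h --> 0^'] --> u ->
    G h @[h --> 0^'] --> w -> b (F h) (G h) @[h --> 0^'] --> b u w.
  by move=> Fu Gw; apply: cvg_comp2 (bc (u, w)).
have bBl u u' w : b (u - u') w = b u w - b u' w.
  by rewrite addrC -scaleN1r bl scaleN1r addrC.
have bBr u w w' : b u (w - w') = b u w - b u w'.
  by rewrite addrC -scaleN1r br scaleN1r addrC.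
have bZl a u w : b (a *: u) w = a *: b u w.
  have b0 : b 0 w = 0 by rewrite -(subrr (0 : V1)) bBl subrr.
  by rewrite -[a *: u]addr0 bl b0 addr0.
have bZr a u w : b u (a *: w) = a *: b u w.
  have b0 : b u 0 = 0 by rewrite -(subrr (0 : V2)) bBr subrr.
  by rewrite -[a *: w]addr0 br b0 addr0.
have H : (fun h => h^-1 *: (((fun y => b (f y) (g y)) \o shift x) (h *: v) -
    b (f x) (g x))) @ 0^' --> b ('D_v f x) (g x) + b (f x) ('D_v g x).
  rewrite [X in X @ _](_ : _ = (fun h =>
     b (h^-1 *: ((f \o shift x) (h *: v) - f x)) (g (h *: v + x)) +
     b (f x) (h^-1 *: ((g \o shift x) (h *: v) - g x)))); last first.
    apply/funext => h /=; rewrite bZl bZr bBl bBr -scalerDr addrA subrK //.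
  by apply: cvgD; apply: bcc; [exact: df|exact: derivable_line|exact: cvg_cst|exact: dg].
by split; [apply/cvg_ex; eexists; exact: H | apply: cvg_lim H].
Qed.

Lemma continuous_bilinear V V1 V2 W (b : V1 -> V2 -> W) f g (x : V) :
  cont_bilinear b -> {for x, continuous f} -> {for x, continuous g} ->
  {for x, continuous (fun y => b (f y) (g y))}.
Proof.
move=> [_ _ bc] cf cg; rewrite /prop_for /continuous_at.
by apply: cvg_comp2 (bc (f x, g x)); [exact: cf|exact: cg].
Qed.

Lemma Ck_bilinear V V1 V2 W (b : V1 -> V2 -> W) k (U : set V) f g :
  cont_bilinear b -> open U ->
  Ck k U f -> Ck k U g -> Ck k U (fun y => b (f y) (g y)).
Proof.
move=> hb oU; elim: k f g => [|k IH] f g Cf Cg.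
  split=> // x Ux.
  by apply: (continuous_bilinear hb (Ck_cont Cf Ux) (Ck_cont Cg Ux)).
split=> [x Ux|].
  by apply: (continuous_bilinear hb (Ck_cont Cf Ux) (Ck_cont Cg Ux)).
split=> [x v Ux|v].
  by have [] := is_derive_bilinear (v := v) hb (Ck_derivable Cf Ux) (Ck_derivable Cg Ux).
have C1 := CkD oU (IH _ _ (Ck_derive v Cf) (CkS Cg)) (IH _ _ (CkS Cf) (Ck_derive v Cg)).
apply: Ck_eq_on oU _ C1 => x; rewrite inE => Ux.
by have [_ ->] := is_derive_bilinear (v := v) hb (Ck_derivable Cf Ux) (Ck_derivable Cg Ux).
Qed.

Lemma is_derive_linear V W W' (l : {linear W -> W'}) f (x v : V) :
  continuous l -> derivable f x v ->
  is_derive x v (fun y => l (f y)) (l ('D_v f x)).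
Proof.
move=> cl df.
have H : (fun h => h^-1 *: (((fun y => l (f y)) \o shift x) (h *: v) -
    l (f x))) @ 0^' --> l ('D_v f x).
  rewrite [X in X @ _](_ : _ = (fun h =>
     l (h^-1 *: ((f \o shift x) (h *: v) - f x)))); last first.
    by apply/funext => h /=; rewrite [RHS]linearZ_LR (linearB l).
  apply: (cvg_comp _ l df (cl _)).
by split; [apply/cvg_ex; eexists; exact: H | apply: cvg_lim H].
Qed.

Lemma Ck_linear V W W' (l : {linear W -> W'}) k (U : set V) f :
  continuous l -> open U -> Ck k U f -> Ck k U (fun y => l (f y)).
Proof.
move=> cl oU; elim: k f => [|k IH] f Cf.
  by split=> // x Ux; apply: continuous_comp; [exact: Ck_cont Cf Ux|exact: cl].
split.
  by move=> x Ux; apply: continuous_comp; [exact: Ck_cont Cf Ux|exact: cl].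
split=> [x v Ux|v]; first by have [] := is_derive_linear (v := v) cl (Ck_derivable Cf Ux).
apply: Ck_eq_on oU _ (IH _ (Ck_derive v Cf)) => x; rewrite inE => Ux.
by have [_ ->] := is_derive_linear (v := v) cl (Ck_derivable Cf Ux).
Qed.

End ClassCk.

(** * Mean values and differentiability of C^1 functions *)

Section MeanValue.
Variable R : realType.
Implicit Types V W : normedModType R.

Lemma difference_quotient_line V W (f : V -> W) x v t :
  (fun h : R => h^-1 *: (((fun s => f (s *: v + x)) \o shift t) (h *: (1 : R))
      - f (t *: v + x))) =
  (fun h => h^-1 *: ((f \o shift (t *: v + x)) (h *: v) - f (t *: v + x))).
Proof.
by apply/funext => h /=; rewrite [h *: 1]mulr1 scalerDl addrA.
Qed.

Lemma derivable_lineE V W (f : V -> W) x v t :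
  derivable (fun s : R => f (s *: v + x)) t 1 = derivable f (t *: v + x) v.
Proof. by rewrite /derivable difference_quotient_line. Qed.

Lemma derive_lineE V W (f : V -> W) x v t :
  'D_1 (fun s : R => f (s *: v + x)) t = 'D_v f (t *: v + x).
Proof. by rewrite /derive difference_quotient_line. Qed.

(** On the line through [x] along [v], [f] is a function of one variable, whose
    differential is linear. *)
Lemma deriveZdir V W (f : V -> W) x v (a : R) :
  derivable f x v -> 'D_(a *: v) f x = a *: 'D_v f x.
Proof.
move=> df.
pose phi s := f (s *: v + x).
have dphi : differentiable phi 0.
  by apply: (derivable1_diffP _ _).1; rewrite derivable_lineE scale0r add0r.
have -> : 'D_(a *: v) f x = 'D_a phi 0.
  rewrite /derive; set g1 := fun h => h^-1 *: _; set g2 := fun h => h^-1 *: _.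
  suff -> : g1 = g2 by [].
  by apply/funext => h; rewrite /g1 /g2 /phi /= scale0r add0r addr0 scalerA.
have -> : 'D_v f x = 'D_1 phi 0 by rewrite derive_lineE scale0r add0r.
by rewrite !deriveE // -linearZ /= [a *: 1]mulr1.
Qed.

Lemma differentiable_of_bound V W (f : V -> W) x (L : {linear V -> W}) :
  continuous L ->
  (forall e : R, 0 < e ->
     \forall k \near (0 : V), `|f (k + x) - f x - L k| <= e * `|k|) ->
  differentiable f x.
Proof.
move=> cL fL.
have H : f \o shift x = cst (f x) + L +o_ 0 id.
  apply/eqaddoP => e e0; apply: filterS (fL e e0) => k.
  by rewrite !fctE /= opprD addrA.
have dE := diff_unique cL H.
by apply/diff_locallyP; rewrite dE.
Qed.

Lemma MVT_line V (f : V -> R) x v :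
  (forall t, t \in `[0, 1]%R -> derivable f (t *: v + x) v) ->
  exists2 t, t \in `]0, 1[%R & f (v + x) - f x = 'D_v f (t *: v + x).
Proof.
move=> df; pose phi (s : R) := f (s *: v + x).
have dphi t : t \in `[0, 1]%R -> derivable phi t 1.
  by move=> t01; rewrite /phi derivable_lineE; apply: df.
have dphi' (s : R) : s \in `]0, 1[%R -> is_derive s 1 phi ('D_v f (s *: v + x)).
  move=> s01; rewrite -derive_lineE; apply/derivableP/dphi.
  by apply: subset_itv_oo_cc.
have cphi : {within `[0, 1], continuous phi}.
  by apply: derivable_within_continuous => s s01; exact: dphi.
have [t t01] := MVT ltr01 dphi' cphi.
rewrite /phi scale1r scale0r add0r subr0 mulr1 => e.
by exists t.
Qed.
End MeanValue.

Section PartialDerivatives.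
Variables (R : realType) (d : nat).
Implicit Types x k : 'rV[R]_d.

Lemma normr_coord k j : `|k 0 j| <= `|k|.
Proof.
by rewrite [leRHS]/Num.Def.normr/= mx_normrE; exact: (le_bigmax _ _ (ord0, j)).
Qed.

Lemma normr_le_coord k (r : R) : 0 <= r -> (forall j, `|k 0 j| <= r) -> `|k| <= r.
Proof.
move=> r0 H; rewrite [leLHS]/Num.Def.normr/= mx_normrE bigmax_le //= => -[i j] _.
by rewrite ord1.
Qed.

(** Go from [x] to [k + x] along one coordinate direction after the other, and
    apply the mean value theorem on each edge of this path. *)
Lemma partial_MVT (f : 'rV[R]_d -> R) (x k : 'rV[R]_d) :
  (forall y v, `|y - x| <= `|k| -> derivable f y v) ->
  exists2 z : 'I_d -> 'rV[R]_d, forall j, `|z j - x| <= `|k| &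
    f (k + x) - f x = \sum_j k 0 j * 'D_(e_ R j) f (z j).
Proof.
move=> df.
(* The vertices of the path, relative to x. *)
pose p (j : nat) : 'rV[R]_d := \row_i (if (i < j)%N then k 0 i else 0).
have pS (j : 'I_d) : p j.+1 = k 0 j *: e_ R j + p j.
  apply/rowP => i; rewrite !mxE eqxx /= ltnS leq_eqVlt.
  have [->|ij] := eqVneq i j; first by rewrite eqxx ltnn mulr1 addr0.
  by rewrite (inj_eq val_inj) (negPf ij) mulr0 add0r.
have step (j : 'I_d) : exists2 z, `|z - x| <= `|k| &
    f (p j.+1 + x) - f (p j + x) = k 0 j * 'D_(e_ R j) f z.
  have bnd t : t \in `[0, 1]%R -> `|t *: (k 0 j *: e_ R j) + (p j + x) - x| <= `|k|.
    rewrite in_itv /= => /andP[t0 t1].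
    rewrite addrA addrK; apply: normr_le_coord => // i; rewrite !mxE eqxx /=.
    have [->|ij] := eqVneq i j.
      rewrite ltnn addr0 mulr1 normrM (ger0_norm t0).
      apply: le_trans (normr_coord k j); exact: ler_piMl.
    rewrite !mulr0 add0r; case: ifP => _; first exact: normr_coord.
    by rewrite normr0.
  have [|t t01] := @MVT_line R _ f (p j + x) (k 0 j *: e_ R j).
    by move=> t t01; apply: df; exact: bnd.
  have t01' : t \in `[0, 1]%R by apply: subset_itv_oo_cc.
  rewrite addrA -pS => ->.
  exists (t *: (k 0 j *: e_ R j) + (p j + x)); first exact: bnd.
  by rewrite deriveZdir //; apply: df; apply: bnd.
have [z Hz1 Hz2] : exists2 z : 'I_d -> 'rV[R]_d, forall j, `|z j - x| <= `|k| &
   forall j : 'I_d, f (p j.+1 + x) - f (p j + x) = k 0 j * 'D_(e_ R j) f (z j).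
  exists (fun j => sval (cid2 (step j))) => j; by case: (cid2 (step j)).
exists z => //.
under eq_bigr do rewrite -Hz2.
rewrite -(big_mkord xpredT (fun j => f (p j.+1 + x) - f (p j + x))).
rewrite telescope_sumr //; congr (f (_ + _) - f _).
  by apply/rowP => i; rewrite mxE ltn_ord.
by rewrite -[LHS]add0r; congr (_ + _); apply/rowP => i; rewrite !mxE.
Qed.

(** The intermediate points of [partial_MVT] tend to [x] with the increment, so
    that continuity of the partial derivatives at [x] bounds the remainder. *)
Lemma C1_differentiable_scalar (U : set 'rV[R]_d) (f : 'rV[R]_d -> R) x :
  open U -> Ck 1 U f -> U x -> differentiable f x.
Proof.
move=> oU Cf Ux.
pose c : 'cV[R]_d := \col_j 'D_(e_ R j) f x.
pose L0 k : R := (k *m c) 0 0.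
have L0lin : linear (L0 : _ -> R).
  by move=> a u v; rewrite /L0 mulmxDl -scalemxAl !mxE.
pose L0M := GRing.isLinear.Build R _ R _ L0 L0lin.
pose L : {linear 'rV[R]_d -> R} := HB.pack L0 L0M.
have LE k : L k = \sum_j k 0 j * 'D_(e_ R j) f x.
  by rewrite /= /L0 mxE; apply: eq_bigr => j _; rewrite mxE.
have cL : continuous L.
  apply/linear_bounded_continuous/bounded_funP => r.
  exists (\sum_j `|r| * `|'D_(e_ R j) f x|) => k kr; rewrite LE.
  apply: le_trans (ler_norm_sum _ _ _) _; apply: ler_sum => j _.
  rewrite normrM; apply: ler_wpM2r => //.
  by apply: le_trans (normr_coord k j) _; apply: le_trans kr (ler_norm r).
apply: (differentiable_of_bound cL) => e e0.
(* The d coordinates share the error; d.+1 avoids a division by zero. *)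
pose e' := e / d.+1%:R.
have e'0 : 0 < e' by rewrite divr_gt0.
have nU : nbhs x U by exact: open_nbhs_nbhs.
have nD : \forall y \near x, U y /\
    forall j : 'I_d, `|'D_(e_ R j) f x - 'D_(e_ R j) f y| < e'.
  have nQ : \forall y \near x, forall j : 'I_d,
      `|'D_(e_ R j) f x - 'D_(e_ R j) f y| < e'; last by near=> y; split; near: y.
  apply: (@filter_forall _ _
    (fun j y => `|'D_(e_ R j) f x - 'D_(e_ R j) f y| < e') (nbhs x)) => j.
  have cj := Ck_cont (Ck_derive (e_ R j) Cf) Ux.
  by move/cvgrPdist_lt: cj; apply.
have [r /= r0 Hr] := (@nbhs_normP _ _ _ _).1 nD.
have n0 : \forall k \near (0 : 'rV[R]_d), `|k| < r.
  by apply: nbhs0_lt.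
apply: filterS n0 => k kr.
have Hz z : `|z - x| <= `|k| ->
    U z /\ forall j : 'I_d, `|'D_(e_ R j) f x - 'D_(e_ R j) f z| < e'.
  by move=> zk; apply: Hr; rewrite /= distrC; apply: le_lt_trans kr.
have [|z zk Ez] := @partial_MVT f x k.
  by move=> y v /Hz [Uy _]; exact: Ck_derivable Cf Uy.
have E : f (k + x) - f x - L k = \sum_j (k 0 j * 'D_(e_ R j) f (z j) -
    k 0 j * 'D_(e_ R j) f x) by rewrite sumrB -LE -Ez.
rewrite [X in `|X|]E.
apply: le_trans (ler_norm_sum _ _ _) _.
apply: (@le_trans _ _ (\sum_(j < d) (e' * `|k|))).
  apply: ler_sum => j _; rewrite -mulrBr normrM mulrC.
  apply: ler_pM => //; last exact: normr_coord.
  by rewrite distrC; apply: ltW; have [_] := Hz _ (zk j); apply.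
rewrite sumr_const card_ord -mulr_natl mulrA; apply: ler_wpM2r => //.
rewrite /e' mulrC -mulrA ler_piMr //; first exact: ltW.
by rewrite ler_pdivrMl ?ltr0Sn // mulr1 ler_nat.
Unshelve. all: by end_near. Qed.
End PartialDerivatives.

(** * Symmetry of second derivatives *)

Section Schwarz.
Variable R : realType.
Implicit Types V W : normedModType R.

Lemma nbhs_norm_ex V (x : V) (P : set V) :
  nbhs x P -> exists2 r : R, 0 < r & forall y, `|x - y| < r -> P y.
Proof. by move=> /nbhs_normP[r /= r0 Hr]; exists r => // y; exact: Hr. Qed.

Lemma difference_quotient_shift V W (f : V -> W) w x u :
  (fun h : R => h^-1 *: (((fun y => f (w + y)) \o shift x) (h *: u) - f (w + x)))
  = (fun h => h^-1 *: ((f \o shift (w + x)) (h *: u) - f (w + x))).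
Proof. by apply/funext => h /=; rewrite addrCA. Qed.

Lemma is_derive_shiftl V W (f : V -> W) w x u : derivable f (w + x) u ->
  is_derive x u (fun y => f (w + y)) ('D_u f (w + x)).
Proof. by move=> df; split; rewrite /derivable /derive difference_quotient_shift. Qed.

(** Two applications of the mean value theorem: along [u] to the increment of [f]
    by [h *: v], then along [v] to the derivative of [f] along [u]. *)
Lemma second_difference V (U : set V) (f : V -> R) (x u v : V) (h : R) :
  0 < h -> Ck 2 U f ->
  (forall y, `|y - x| <= h * (`|u| + `|v|) -> U y) ->
  exists2 y, `|y - x| <= h * (`|u| + `|v|) &
    (f (h *: v + (h *: u + x)) - f (h *: u + x)) - (f (h *: v + x) - f x)
    = h * (h * 'D_v ('D_u f) y).
Proof.
move=> h0 Cf HU.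
have bnd s t : s \in `[0, 1]%R -> t \in `[0, 1]%R ->
    `|s *: (h *: v) + (t *: (h *: u) + x) - x| <= h * (`|u| + `|v|).
  rewrite !in_itv /= => /andP[s0 s1] /andP[t0 t1].
  rewrite addrA addrK addrC; apply: le_trans (ler_normD _ _) _.
  rewrite mulrDr !normrZ !(ger0_norm _) ?(ltW h0) //.
  by apply: lerD; apply: ler_piMl => //; rewrite mulr_ge0 // ltW.
have z01 : (0 : R) \in `[0, 1]%R by rewrite in_itv /= lexx ler01.
have o01 : (1 : R) \in `[0, 1]%R by rewrite in_itv /= lexx ler01.
have oo01 (t : R) : t \in `]0, 1[%R -> t \in `[0, 1]%R.
  by apply: subset_itv_oo_cc.
pose F y := f (h *: v + y) - f y.
have dF t : t \in `[0, 1]%R -> is_derive (t *: (h *: u) + x) (h *: u) F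
    ('D_(h *: u) f (h *: v + (t *: (h *: u) + x)) -
     'D_(h *: u) f (t *: (h *: u) + x)).
  move=> t01; apply: is_deriveB.
    apply: is_derive_shiftl; apply: Ck_derivable Cf _.
    by apply: HU; have := bnd 1 t o01 t01; rewrite scale1r.
  apply: derivableP; apply: Ck_derivable Cf _.
  by apply: HU; have := bnd 0 t z01 t01; rewrite scale0r add0r.
have [|t t01 Et] := @MVT_line R V F x (h *: u).
  by move=> t t01; have [] := dF t t01.
have [|s s01 Es] := @MVT_line R V ('D_u f) (t *: (h *: u) + x) (h *: v).
  move=> s s01; apply: Ck_derivable (Ck_derive u Cf) _.
  by apply: HU; apply: bnd s01 (oo01 _ t01).
exists (s *: (h *: v) + (t *: (h *: u) + x)); first by apply: bnd; exact: oo01.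
have := dF _ (oo01 _ t01) => -[_ E]; rewrite -/(F (h *: u + x)) -/(F x) Et E.
rewrite !deriveZdir.
- rewrite -scalerBr Es deriveZdir //.
  apply: Ck_derivable (Ck_derive u Cf) _.
  by apply: HU; apply: bnd; exact: oo01.
- apply: Ck_derivable Cf _.
  by apply: HU; have := bnd 0 t z01 (oo01 _ t01); rewrite scale0r add0r.
- apply: Ck_derivable Cf _.
  by apply: HU; have := bnd 1 t o01 (oo01 _ t01); rewrite scale1r.
Qed.

(** The second difference is symmetric in [u] and [v], so both mixed derivatives
    take the same value at two points that can be chosen close to [x]. *)
Lemma schwarz_scalar V (U : set V) (f : V -> R) (x u v : V) :
  open U -> Ck 2 U f -> U x -> 'D_u ('D_v f) x = 'D_v ('D_u f) x.
Proof.
move=> oU Cf Ux.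
have nU : nbhs x U by exact: open_nbhs_nbhs.
apply/eqP; rewrite -subr_eq0 -normr_le0; apply/ler_addgt0Pr => e e0.
rewrite add0r.
have e20 : 0 < e / 2 by rewrite divr_gt0.
have c1 := Ck_cont (Ck_derive u (Ck_derive v Cf)) Ux.
have c2 := Ck_cont (Ck_derive v (Ck_derive u Cf)) Ux.
move/cvgrPdist_lt: c1 => /(_ _ e20) n1.
move/cvgrPdist_lt: c2 => /(_ _ e20) n2.
have [r r0 Hr] := nbhs_norm_ex (filterI nU (filterI n1 n2)).
pose h := r / 2 / (`|u| + `|v| + 1).
have h0 : 0 < h by rewrite !divr_gt0 // ltr_wpDl // addr_ge0.
have hr : h * (`|u| + `|v|) < r.
  apply: (@le_lt_trans _ _ (r / 2)); last by rewrite ltr_pdivrMr // ltr_pMr // ltr1n.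
  rewrite /h -mulrA ler_piMr //; first by rewrite ltW // divr_gt0.
  by rewrite ler_pdivrMl ?mulr1 ?lerDl // ltr_wpDl // addr_ge0.
have Hr' y : `|y - x| <= h * (`|u| + `|v|) -> [/\ U y,
   `|'D_u ('D_v f) x - 'D_u ('D_v f) y| < e / 2 &
   `|'D_v ('D_u f) x - 'D_v ('D_u f) y| < e / 2].
  move=> yx; have yr : `|x - y| < r by rewrite distrC; apply: le_lt_trans hr.
  have [Uy [H1 H2]] := Hr y yr.
  by split; [exact Uy|exact H1|exact H2].
have [|y yx Ey] := second_difference h0 Cf (x := x) (u := u) (v := v).
  by move=> y /Hr' [].
have [|z zx Ez] := second_difference h0 Cf (x := x) (u := v) (v := u).
  by move=> z; rewrite [`|v| + _]addrC => /Hr' [].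
rewrite [`|v| + _]addrC in zx.
have E : 'D_v ('D_u f) y = 'D_u ('D_v f) z.
  apply: (mulfI (lt0r_neq0 h0)); apply: (mulfI (lt0r_neq0 h0)).
  have Exy : h *: v + (h *: u + x) = h *: u + (h *: v + x) by rewrite addrCA.
  apply: (etrans (esym Ey)); apply: (etrans _ Ez); rewrite Exy.
  have aux (a b c t : R) : a - b - (c - t) = a - c - (b - t) by ring.
  exact: aux.
have [_ _ H1] := Hr' y yx; have [_ H2 _] := Hr' z zx.
rewrite -(subrKA ('D_u ('D_v f) z)) [e]splitr.
apply: le_trans (ler_normD _ _) _; apply: lerD; apply: ltW; first exact H2.
by rewrite -E distrC; exact H1.
Qed.

End Schwarz.

(** * Maps into finite dimensional spaces *)

Section FiniteDimensionalTargets.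
Variable R : realType.
Implicit Types V W : normedModType R.

(** Statements on vector-valued functions are reduced to real-valued ones by
    coordinates.  The coordinates are abstract because the targets are matrix
    spaces and products of them. *)
Definition fincoords W : Prop :=
  exists (I : finType) (l : I -> {linear W -> R}) (e : I -> W),
    (forall i, continuous (l i)) /\ forall w, w = \sum_i l i w *: e i.

Lemma coord_linear m n i j : exists2 l : {linear 'M[R]_(m, n) -> R},
  continuous l & forall A, l A = A i j.
Proof.
have lin : linear (fun A : 'M[R]_(m, n) => A i j : R).
  by move=> a A B; rewrite !mxE.
pose lM := GRing.isLinear.Build R _ R _ _ lin.
pose l : {linear 'M[R]_(m, n) -> R} := HB.pack (fun A : 'M[R]_(m, n) => A i j : R) lM.
by exists l => //; exact: coord_continuous.
Qed.

Lemma fincoords_mx m n : fincoords 'M[R]_(m, n).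
Proof.
have cl (i : 'I_m * 'I_n) := cid2 (coord_linear i.1 i.2).
exists ('I_m * 'I_n)%type, (fun i => sval (cl i)), (fun i => delta_mx i.1 i.2).
split=> [i|A]; first by case: (cl i).
rewrite {1}[A]matrix_sum_delta pair_bigA /=; apply: eq_bigr => i _.
by case: (cl i) => l _ /= ->.
Qed.

Lemma fincoords_prod V W : fincoords V -> fincoords W -> fincoords (V * W)%type.
Proof.
move=> [I [l [e [cl le]]]] [J [m [f [cm mf]]]].
have lin1 i : linear (fun p : V * W => l i p.1 : R).
  by move=> a A B /=; rewrite linearP.
have lin2 j : linear (fun p : V * W => m j p.2 : R).
  by move=> a A B /=; rewrite linearP.
pose L1 i : {linear (V * W)%type -> R} :=
  HB.pack (fun p : V * W => l i p.1 : R) (GRing.isLinear.Build R _ R _ _ (lin1 i)).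
pose L2 j : {linear (V * W)%type -> R} :=
  HB.pack (fun p : V * W => m j p.2 : R) (GRing.isLinear.Build R _ R _ _ (lin2 j)).
exists (I + J)%type, (fun k => match k with inl i => L1 i | inr j => L2 j end),
  (fun k => match k with inl i => (e i, 0) | inr j => (0, f j) end).
split=> [[i|j]|[v w]].
- move=> p /=; apply: (@continuous_comp _ _ _ fst (l i)); [exact: cvg_fst|exact: cl].
- move=> p /=; apply: (@continuous_comp _ _ _ snd (m j)); [exact: cvg_snd|exact: cm].
rewrite big_sumType /=.
have -> : \sum_i l i v *: ((e i, 0) : V * W) = (v, 0).
  rewrite {2}[v]le; elim/big_ind2: _ => //= [a b c t -> ->|i _].
    by congr (_, _); rewrite addr0.
  by congr (_, _); rewrite scaler0.
have -> : \sum_j m j w *: ((0, f j) : V * W) = (0, w).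
  rewrite {2}[w]mf; elim/big_ind2: _ => //= [a b c t -> ->|i _].
    by congr (_, _); rewrite addr0.
  by congr (_, _); rewrite scaler0.
by congr (_, _); rewrite ?addr0 ?add0r.
Qed.

Lemma C1_differentiable d W (U : set 'rV[R]_d) (f : 'rV[R]_d -> W) x :
  fincoords W -> open U -> Ck 1 U f -> U x -> differentiable f x.
Proof.
move=> [I [l [e [cl le]]]] oU Cf Ux.
rewrite (_ : f = (fun y => \sum_i l i (f y) *: e i)); last first.
  by apply/funext => y; exact: le.
elim: (index_enum I) => [|i r IH].
  rewrite (_ : (fun=> _) = cst 0); first exact: differentiable_cst.
  by apply/funext => y; rewrite big_nil.
rewrite (_ : (fun=> _) = (fun y => l i (f y) *: e i) +
   (fun y => \sum_(j <- r) l j (f y) *: e j)); last first.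
  by apply/funext => y; rewrite big_cons.
apply: differentiableD => //; apply: differentiableZl.
by apply: (C1_differentiable_scalar oU _ Ux); apply: (Ck_linear (cl i) oU Cf).
Qed.

Lemma schwarz V W (U : set V) (f : V -> W) x u v :
  fincoords W -> open U -> Ck 2 U f -> U x ->
  'D_u ('D_v f) x = 'D_v ('D_u f) x.
Proof.
move=> [I [l [e [cl le]]]] oU Cf Ux.
have E0 w1 w2 : (forall i, l i w1 = l i w2) -> w1 = w2.
  by move=> lw; rewrite (le w1) (le w2); apply: eq_bigr => i _; rewrite lw.
apply: E0 => i.
have E a b : l i ('D_a ('D_b f) x) = 'D_a ('D_b (fun y => l i (f y))) x.
  have [_ <-] := is_derive_linear (cl i) (Ck_derivable (v := a) (Ck_derive b Cf) Ux).
  apply: (derive_eq_on _ oU _ Ux) => y; rewrite inE => Uy.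
  by have [_ ->] := is_derive_linear (cl i) (Ck_derivable (v := b) (CkS Cf) Uy).
by rewrite !E; apply: (schwarz_scalar _ _ oU _ Ux); apply: (Ck_linear (cl i) oU Cf).
Qed.

Lemma scale_bilinear W : cont_bilinear (fun (a : R) (w : W) => a *: w).
Proof.
split=> [a u u' v|a u v v'|].
- by rewrite scalerDl scalerA.
- by rewrite scalerDr !scalerA mulrC.
- by move=> [a w]; exact: scale_continuous.
Qed.

Lemma derive_basis d W (f : 'rV[R]_d -> W) x v : differentiable f x ->
  'D_v f x = \sum_i v 0 i *: 'D_(e_ R i) f x.
Proof.
move=> df; rewrite deriveE // {1}(row_sum_delta v) linear_sum.
by apply: eq_bigr => i _; rewrite linearZ /= deriveE.
Qed.

Lemma derive_comp V V' W (f : V -> V') (g : V' -> W) x v :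
  differentiable f x -> differentiable g (f x) ->
  derivable (g \o f) x v /\ 'D_v (g \o f) x = 'D_('D_v f x) g (f x).
Proof.
move=> df dg; have dgf := differentiable_comp df dg.
split; first exact: diff_derivable.
by rewrite !deriveE // diff_comp.
Qed.

Lemma Ck_coord V m n k (U : set V) (f : V -> 'M[R]_(m, n)) i j :
  open U -> Ck k U f -> Ck k U (fun x => f x i j).
Proof.
move=> oU Cf; have [l cl lE] := coord_linear i j.
by apply: Ck_eq_on oU _ (Ck_linear cl oU Cf) => x _; rewrite lE.
Qed.

Lemma is_derive_coord V m n (f : V -> 'M[R]_(m, n)) i j x v :
  derivable f x v -> is_derive x v (fun x => f x i j) ('D_v f x i j).
Proof.
move=> df; have [l cl lE] := coord_linear i j.
by have := is_derive_linear cl df; rewrite lE (_ : (fun y => l (f y)) = (fun y => f y i j)) //;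
  apply/funext => y.
Qed.

(** The chain rule writes a directional derivative of [g \o f] as a sum of
    products of derivatives of [f] with derivatives of [g] composed with [f],
    which are of class C^k by induction. *)
Lemma Ck_comp m d W k (U : set 'rV[R]_m) (O : set 'rV[R]_d) f (g : _ -> W) :
  fincoords W -> open U -> open O -> f @` U `<=` O ->
  Ck k U f -> Ck k O g -> Ck k U (g \o f).
Proof.
move=> fW oU oO UO; have fO x : U x -> O (f x) by move=> Ux; apply: UO; exists x.
elim: k f g UO fO => [|k IH] f g UO fO Cf Cg.
  split=> // x Ux; apply: continuous_comp; first exact: Ck_cont Cf Ux.
  exact: Ck_cont Cg (fO _ Ux).
have dfg x v : U x -> derivable (g \o f) x v /\
    'D_v (g \o f) x = \sum_i 'D_v f x 0 i *: 'D_(e_ R i) g (f x).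
  move=> Ux.
  have df := C1_differentiable (fincoords_mx _ _) oU (Ck_le (ltn0Sn k) Cf) Ux.
  have dg := C1_differentiable fW oO (Ck_le (ltn0Sn k) Cg) (fO _ Ux).
  by have [? ->] := derive_comp v df dg; rewrite (derive_basis _ dg).
split=> [x Ux|].
  apply: continuous_comp; first exact: Ck_cont Cf Ux.
  exact: Ck_cont Cg (fO _ Ux).
split=> [x v Ux|v]; first by have [] := dfg x v Ux.
have C2 : Ck k U (fun x => \sum_i 'D_v f x 0 i *: ('D_(e_ R i) g \o f) x).
  apply: (Ck_sum _ oU) => i; apply: (Ck_bilinear (scale_bilinear W) oU).
    exact: Ck_coord oU (Ck_derive v Cf).
  by apply: IH => //; [exact: CkS|exact: Ck_derive].
apply: (Ck_eq_on oU _ C2) => x; rewrite inE => Ux.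
by have [_ ->] := dfg x v Ux.
Qed.

End FiniteDimensionalTargets.

(** * The ambient space and its quadric *)

Section Ambient.
Variables (R : realType) (n : nat) (M : space_form n).
Notation K := (Kspace R n).
Notation ip := (@ip R n M).
Notation J := (@Jmul R n M).

(** [J] squares to [- Jsign] and multiplies the metric by [Jsign] ([JJ],
    [ip_JJ]). *)
Definition Jsign : R := if M is CP _ _ then 1 else -1.

(** The diagonal coefficients of the metric on the two halves of the coordinates,
    which allow the complex and para-complex cases to be treated together. *)
Definition sgn1 (j : 'I_n.+1) : R :=
  if M is CP p _ then (-1) ^+ (j < p)%N else 1.
Definition sgn2 (j : 'I_n.+1) : R :=
  if M is CP p _ then (-1) ^+ (j < p)%N else -1.

Lemma ipE z w :
  ip z w = \sum_j (sgn1 j * (z.1 0 j * w.1 0 j) + sgn2 j * (z.2 0 j * w.2 0 j)).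
Proof.
rewrite /ip /Defs.ip /sgn1 /sgn2; case: M => [p b||]; apply: eq_bigr => j _.
- by rewrite mulrDr.
- by rewrite mul1r mulN1r.
- by rewrite mul1r mulN1r.
Qed.

Lemma Jsign_sqr : Jsign * Jsign = 1.
Proof. by rewrite /Jsign; case: M => *; rewrite ?mulrNN mulr1. Qed.

Lemma Jsign_neq0 : Jsign != 0.
Proof. by rewrite /Jsign; case: M => *; rewrite ?oppr_eq0 oner_neq0. Qed.

Lemma level_neq0 : level R M != 0.
Proof.
by rewrite /level; case: M => *; rewrite ?signr_eq0 ?oppr_eq0 ?oner_neq0.
Qed.

Lemma sgn1_neq0 j : sgn1 j != 0.
Proof. by rewrite /sgn1; case: M => *; rewrite ?signr_eq0 ?oner_eq0. Qed.

Lemma sgn2_neq0 j : sgn2 j != 0.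
Proof. by rewrite /sgn2; case: M => *; rewrite ?signr_eq0 ?oppr_eq0 ?oner_eq0. Qed.

Lemma ip_sym z w : ip z w = ip w z.
Proof.
by rewrite !ipE; apply: eq_bigr => j _; rewrite [z.1 0 j * _]mulrC [z.2 0 j * _]mulrC.
Qed.

Lemma ip_linl a u v w : ip (a *: u + v) w = a * ip u w + ip v w.
Proof.
rewrite !ipE mulr_sumr -big_split /=; apply: eq_bigr => j _.
by rewrite !mxE /=; ring.
Qed.

Lemma ipDl u v w : ip (u + v) w = ip u w + ip v w.
Proof. by have := ip_linl 1 u v w; rewrite scale1r mul1r. Qed.
Lemma ip0l w : ip 0 w = 0.
Proof. by have := ip_linl (-1) 0 0 w; rewrite scaler0 addr0 mulN1r addNr. Qed.
Lemma ipZl a u w : ip (a *: u) w = a * ip u w.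
Proof. by have := ip_linl a u 0 w; rewrite ip0l !addr0. Qed.
Lemma ipNl u w : ip (- u) w = - ip u w.
Proof. by rewrite -scaleN1r ipZl mulN1r. Qed.
Lemma ipBl u v w : ip (u - v) w = ip u w - ip v w.
Proof. by rewrite ipDl ipNl. Qed.
Lemma ipDr u v w : ip w (u + v) = ip w u + ip w v.
Proof. by rewrite ip_sym ipDl !(ip_sym _ w). Qed.
Lemma ipZr a u w : ip w (a *: u) = a * ip w u.
Proof. by rewrite ip_sym ipZl ip_sym. Qed.
Lemma ipNr u w : ip w (- u) = - ip w u.
Proof. by rewrite ip_sym ipNl ip_sym. Qed.
Lemma ipBr u v w : ip w (u - v) = ip w u - ip w v.
Proof. by rewrite ipDr ipNr. Qed.
Lemma ip_suml (I : Type) (r : seq I) (F : I -> K) w :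
  ip (\sum_(i <- r) F i) w = \sum_(i <- r) ip (F i) w.
Proof. by elim/big_rec2: _ => [|i a b _ <-]; rewrite ?ip0l ?ipDl. Qed.
Lemma ip_sumr (I : Type) (r : seq I) (F : I -> K) w :
  ip w (\sum_(i <- r) F i) = \sum_(i <- r) ip w (F i).
Proof. by rewrite ip_sym ip_suml; apply: eq_bigr => i _; rewrite ip_sym. Qed.

Lemma ip_nondeg z : (forall w, ip z w = 0) -> z = 0.
Proof.
case: z => x y H; congr (_, _); apply/rowP => j; rewrite mxE.
  have := H (delta_mx 0 j, 0); rewrite ipE /= (bigD1 j) //= big1 => [|i ij].
    rewrite !mxE !eqxx /= mulr1 !mulr0 !addr0 => /eqP.
    by rewrite mulf_eq0 (negPf (sgn1_neq0 j)) => /eqP.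
  by rewrite !mxE eqxx (negPf ij) /= !mulr0 addr0.
have := H (0, delta_mx 0 j); rewrite ipE /= (bigD1 j) //= big1 => [|i ij].
  rewrite !mxE !eqxx /= mulr1 !mulr0 add0r addr0 => /eqP.
  by rewrite mulf_eq0 (negPf (sgn2_neq0 j)) => /eqP.
by rewrite !mxE eqxx (negPf ij) /= !mulr0 addr0.
Qed.

Lemma J_lin a u v : J (a *: u + v) = a *: J u + J v.
Proof.
rewrite /Jmul; case: M => [p b||]; case: u v => [u1 u2] [v1 v2];
  congr (_, _); by rewrite /= ?opprD ?scalerN.
Qed.
Lemma JD u v : J (u + v) = J u + J v.
Proof. by have := J_lin 1 u v; rewrite !scale1r. Qed.
Lemma J0 : J 0 = 0.
Proof. by have := J_lin (-1) 0 0; rewrite scaler0 addr0 scaleN1r addNr. Qed.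
Lemma JZ a u : J (a *: u) = a *: J u.
Proof. by have := J_lin a u 0; rewrite J0 !addr0. Qed.
Lemma JN u : J (- u) = - J u.
Proof. by rewrite -scaleN1r JZ scaleN1r. Qed.
Lemma JB u v : J (u - v) = J u - J v.
Proof. by rewrite JD JN. Qed.
Lemma J_sum (I : Type) (r : seq I) (F : I -> K) :
  J (\sum_(i <- r) F i) = \sum_(i <- r) J (F i).
Proof. by elim/big_rec2: _ => [|i a b _ <-]; rewrite ?J0 ?JD. Qed.

Lemma JJ z : J (J z) = - (Jsign *: z).
Proof.
rewrite /Jmul /Jsign; case: M => [p b||]; case: z => x y; congr (_, _) => /=.
all: by rewrite ?scale1r ?scaleN1r ?opprK.
Qed.

Lemma ip_JJ z w : ip (J z) (J w) = Jsign * ip z w.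
Proof.
rewrite !ipE mulr_sumr; apply: eq_bigr => j _.
rewrite /Jmul /Jsign /sgn1 /sgn2; case: M => [p b||] /=; rewrite ?mxE; ring.
Qed.

(** [J] is skew, by [JJ] and [ip_JJ]: <z, J w> is an alternating form. *)
Lemma ip_Jr z w : ip z (J w) = - ip (J z) w.
Proof.
have := ip_JJ (J z) w; rewrite JJ ipNl ipZl => /eqP.
rewrite -mulrN (inj_eq (mulfI Jsign_neq0)) => /eqP <-.
by rewrite opprK.
Qed.

Lemma ip_J_self z : ip z (J z) = 0.
Proof.
have : ip z (J z) = - ip z (J z) by rewrite {1}ip_Jr ip_sym.
by lra.
Qed.

Lemma ip_bilinear : cont_bilinear ip.
Proof.
split=> [a u u' v|a u v v'|]; first exact: ip_linl.
  by rewrite ipDr ipZr.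
rewrite (_ : (fun p => _) = (fun p : K * K => \sum_j
  (sgn1 j * (p.1.1 0 j * p.2.1 0 j) + sgn2 j * (p.1.2 0 j * p.2.2 0 j)))); last first.
  by apply/funext => p; rewrite ipE.
have c11 j : continuous (fun p : K * K => p.1.1 0 j : R).
  move=> p; apply: (@continuous_comp _ _ _ (fun p : K * K => p.1.1) (fun A : 'rV[R]_n.+1 => A 0 j)).
    by apply: (@continuous_comp _ _ _ fst fst); exact: cvg_fst.
  exact: coord_continuous.
have c12 j : continuous (fun p : K * K => p.1.2 0 j : R).
  move=> p; apply: (@continuous_comp _ _ _ (fun p : K * K => p.1.2) (fun A : 'rV[R]_n.+1 => A 0 j)).
    by apply: (@continuous_comp _ _ _ fst snd); [exact: cvg_fst|exact: cvg_snd].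
  exact: coord_continuous.
have c21 j : continuous (fun p : K * K => p.2.1 0 j : R).
  move=> p; apply: (@continuous_comp _ _ _ (fun p : K * K => p.2.1) (fun A : 'rV[R]_n.+1 => A 0 j)).
    by apply: (@continuous_comp _ _ _ snd fst); [exact: cvg_snd|exact: cvg_fst].
  exact: coord_continuous.
have c22 j : continuous (fun p : K * K => p.2.2 0 j : R).
  move=> p; apply: (@continuous_comp _ _ _ (fun p : K * K => p.2.2) (fun A : 'rV[R]_n.+1 => A 0 j)).
    by apply: (@continuous_comp _ _ _ snd snd); exact: cvg_snd.
  exact: coord_continuous.
elim: (index_enum _) => [|j r IH] p.
  rewrite (_ : (fun=> _) = (fun=> 0)); first exact: cst_continuous.
  by apply/funext => q; rewrite big_nil.
rewrite (_ : (fun p : K * K => _) = (fun p : K * K =>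
  (sgn1 j * (p.1.1 0 j * p.2.1 0 j) + sgn2 j * (p.1.2 0 j * p.2.2 0 j)) +
  \sum_(i <- r) (sgn1 i * (p.1.1 0 i * p.2.1 0 i) + sgn2 i * (p.1.2 0 i * p.2.2 0 i)))); last first.
  by apply/funext => q; rewrite big_cons.
apply: cvgD; last exact: IH.
apply: cvgD; (apply: cvgM; first exact: cvg_cst); apply: cvgM.
- exact: c11.
- exact: c21.
- exact: c12.
- exact: c22.
Qed.

Lemma J_continuous_linear : exists2 l : {linear K -> K},
  continuous l & forall z, l z = J z.
Proof.
pose l : {linear K -> K} := HB.pack (J : K -> K) (GRing.isLinear.Build R K K _ _ J_lin).
exists l => //; rewrite /= /Jmul.
case: M => [p b||] z.
- exact: (@cvg_pair _ _ _ (nbhs z) (nbhs (- z.2)) (nbhs z.1) _ _ _ (fun z : K => - z.2)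
   (fun z : K => z.1) (cvgN cvg_snd) cvg_fst).
- exact: (@cvg_pair _ _ _ (nbhs z) (nbhs z.2) (nbhs z.1) _ _ _ (fun z : K => z.2)
   (fun z : K => z.1) cvg_snd cvg_fst).
- exact: (@cvg_pair _ _ _ (nbhs z) (nbhs z.2) (nbhs z.1) _ _ _ (fun z : K => z.2)
   (fun z : K => z.1) cvg_snd cvg_fst).
Qed.

Lemma fincoords_K : fincoords K.
Proof. exact: (fincoords_prod (fincoords_mx R 1 n.+1) (fincoords_mx R 1 n.+1)). Qed.

Lemma Ck_J (V : normedModType R) k (U : set V) (f : V -> K) :
  open U -> Ck k U f -> Ck k U (fun x => J (f x)).
Proof.
move=> oU Cf; have [l cl lE] := J_continuous_linear.
by apply: (Ck_eq_on oU _ (Ck_linear cl oU Cf)) => x _; rewrite lE.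
Qed.

Lemma is_derive_J (V : normedModType R) (f : V -> K) x v : derivable f x v ->
  is_derive x v (fun x => J (f x)) (J ('D_v f x)).
Proof.
move=> df; have [l cl lE] := J_continuous_linear.
have := is_derive_linear cl df; rewrite lE.
by rewrite (_ : (fun y => l (f y)) = (fun x => J (f x))) //; apply/funext => y.
Qed.

End Ambient.

Section Span.
Variables (R : realType) (n : nat) (M : space_form n).
Notation K := ('rV[R]_n.+1 * 'rV[R]_n.+1)%type.
Notation ip := (@ip R n M).

Lemma ip_span (X : seq K) (w v : K) :
  (forall x, x \in X -> ip w x = 0) -> v \in <<X>>%VS -> ip w v = 0.
Proof.
move=> wX vX; rewrite (coord_span (X := in_tuple X) vX) ip_sumr big1 // => i _.
by rewrite ipZr wX ?mulr0 //; apply: mem_nth.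
Qed.

(** A non-null vector orthogonal to a family is not in its span, where it would be
    orthogonal to itself. *)
Lemma free_orth (X : seq K) (p : K) : free X -> ip p p != 0 ->
  (forall x, x \in X -> ip p x = 0) -> free (p :: X).
Proof.
move=> fX pp pX; rewrite free_cons fX andbT; apply/negP => /(ip_span pX) E.
by rewrite E eqxx in pp.
Qed.

(** A free family with as many vectors as the dimension spans the space, and the
    metric is non-degenerate. *)
Lemma free_full_orth (X : seq K) (w : K) : free X -> size X = (n.+1 + n.+1)%N ->
  (forall x, x \in X -> ip w x = 0) -> w = 0.
Proof.
move=> fX sX wX; apply: (@ip_nondeg R n M) => v; apply: (ip_span wX).
have bX : basis_of {:K} X.
  rewrite basisEfree fX subvf /= dimvf sX /dim /=.
  by rewrite /dim /= !mul1n.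
by rewrite (span_basis bX) memvf.
Qed.

End Span.

(** * Lifts to the quadric *)

(** Sealed, like [theta], [hlift], [covd] and [lift_along] below: the computations
    involve many derivatives that differ only by a direction, and telling them
    apart must not unfold the limits that define them. *)
HB.lock Definition der (R : realType) (V W : normedModType R) (v : V)
  (f : V -> W) : V -> W := 'D_v f.

Lemma derE (R : realType) (V W : normedModType R) (v : V) (f : V -> W) :
  der v f = 'D_v f.
Proof. by rewrite der.unlock. Qed.

Section Smooth.
Variables (R : realType) (V W : normedModType R) (U : set V).
Hypothesis oU : open U.

Lemma smooth_derivable (f : V -> W) x v : smooth_on U f -> U x -> derivable f x v.
Proof. by move=> Cf Ux; exact: (Ck_derivable (Cf 1%N) Ux). Qed.

Lemma smooth_derive (f : V -> W) v : smooth_on U f -> smooth_on U (der v f).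
Proof. by move=> Cf k; rewrite derE; exact: (Ck_derive v (Cf k.+1)). Qed.

Lemma smooth_eq (f g : V -> W) : {in U, f =1 g} -> smooth_on U f -> smooth_on U g.
Proof. by move=> fg Cf k; exact: (Ck_eq_on oU fg (Cf k)). Qed.

Lemma smooth_cst (w : W) : smooth_on U (fun=> w).
Proof. by move=> k; exact: Ck_cst. Qed.

Lemma smoothD (f g : V -> W) : smooth_on U f -> smooth_on U g ->
  smooth_on U (fun x => f x + g x).
Proof. by move=> Cf Cg k; exact: (CkD oU (Cf k) (Cg k)). Qed.

Lemma smooth_sum (I : Type) (r : seq I) (f : I -> V -> W) :
  (forall i, smooth_on U (f i)) -> smooth_on U (fun x => \sum_(i <- r) f i x).
Proof. by move=> Cf k; apply: (Ck_sum _ oU) => i; exact: (Cf i k). Qed.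

Lemma smoothZ (a : V -> R) (f : V -> W) : smooth_on U a -> smooth_on U f ->
  smooth_on U (fun x => a x *: f x).
Proof.
by move=> Ca Cf k; exact: (Ck_bilinear (scale_bilinear W) oU (Ca k) (Cf k)).
Qed.

Lemma smoothB (f g : V -> W) : smooth_on U f -> smooth_on U g ->
  smooth_on U (fun x => f x - g x).
Proof.
move=> Cf Cg; apply: smoothD => //.
apply: (@smooth_eq (fun x => (-1) *: g x)); first by move=> x _; rewrite scaleN1r.
by apply: smoothZ => //; move=> k; exact: Ck_cst.
Qed.

Lemma der_scale (a : V -> R) (f : V -> W) x v :
  derivable a x v -> derivable f x v ->
  der v (fun y => a y *: f y) x = der v a x *: f x + a x *: der v f x.
Proof. by move=> da df; rewrite !derE; have [_ ->] := is_derive_bilinear (scale_bilinear W) da df. Qed.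

Lemma der_sub (f g : V -> W) x v : derivable f x v -> derivable g x v ->
  der v (fun y => f y - g y) x = der v f x - der v g x.
Proof. by move=> df dg; rewrite !derE; exact: deriveB. Qed.

Lemma der_sum (I : Type) (r : seq I) (f : I -> V -> W) x v :
  (forall i, derivable (f i) x v) ->
  derivable (fun y => \sum_(i <- r) f i y) x v /\
  der v (fun y => \sum_(i <- r) f i y) x = \sum_(i <- r) der v (f i) x.
Proof.
move=> df; rewrite derE; under [X in _ = X]eq_bigr do rewrite derE.
elim: r => [|i r [d1 IH]].
  rewrite (_ : (fun y => _) = cst 0); last by apply/funext => y; rewrite big_nil.
  by rewrite derive_cst big_nil; split=> //; exact: derivable_cst.
rewrite (_ : (fun y => _) = f i + (fun y => \sum_(j <- r) f j y)); last first.
  by apply/funext => y; rewrite big_cons.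
split; first exact: derivableD.
by rewrite deriveD // IH big_cons.
Qed.

Lemma der_eq_on (f g : V -> W) x v : {in U, f =1 g} -> U x -> der v f x = der v g x.
Proof. by move=> fg Ux; rewrite !derE; exact: (derive_eq_on v oU fg Ux). Qed.

Lemma der_cst (w : W) (x v : V) : der v (fun=> w) x = 0.
Proof. by rewrite derE derive_cst. Qed.

End Smooth.

Section SmoothK.
Variables (R : realType) (n : nat) (M : space_form n) (V : normedModType R).
Variable U : set V.
Hypothesis oU : open U.
Notation K := (Kspace R n).
Notation ip := (@ip R n M).
Notation J := (@Jmul R n M).

Lemma smooth_ip (f g : V -> K) : smooth_on U f -> smooth_on U g ->
  smooth_on U (fun x => ip (f x) (g x)).
Proof.
by move=> Cf Cg k; exact: (Ck_bilinear (ip_bilinear R M) oU (Cf k) (Cg k)).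
Qed.

Lemma smooth_J (f : V -> K) : smooth_on U f -> smooth_on U (fun x => J (f x)).
Proof. by move=> Cf k; exact: (Ck_J M oU (Cf k)). Qed.

Lemma smoothM (f g : V -> R) : smooth_on U f -> smooth_on U g ->
  smooth_on U (fun x => f x * g x).
Proof. exact: (smoothZ oU). Qed.

Lemma der_ip (f g : V -> K) x v : derivable f x v -> derivable g x v ->
  der v (fun y => ip (f y) (g y)) x = ip (der v f x) (g x) + ip (f x) (der v g x).
Proof. by move=> df dg; rewrite !derE; have [_ ->] := is_derive_bilinear (ip_bilinear R M) df dg. Qed.

Lemma der_J (f : V -> K) x v : derivable f x v ->
  der v (fun y => J (f y)) x = J (der v f x).
Proof. by move=> df; rewrite !derE; have [_ ->] := is_derive_J M df. Qed.

Lemma der_mul (f g : V -> R) x v : derivable f x v -> derivable g x v ->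
  der v (fun y => f y * g y) x = der v f x * g x + f x * der v g x.
Proof. by move=> df dg; rewrite (der_scale df dg). Qed.

End SmoothK.

(** The coefficient of [J (s x)] in the derivative of [s] along [v]: the pullback
    by [s] of the connection form of the bundle over the space form. *)
HB.lock Definition theta (R : realType) n (M : space_form n) d
    (s : 'rV[R]_d -> Kspace R n) (v x : 'rV[R]_d) : R :=
  ip M ('D_v s x) (Jmul M (s x)) / ip M (Jmul M (s x)) (Jmul M (s x)).

(** The horizontal lift, at [s x], of the coordinate vector [v]. *)
HB.lock Definition hlift (R : realType) n (M : space_form n) d
    (s : 'rV[R]_d -> Kspace R n) (v x : 'rV[R]_d) : Kspace R n :=
  horizontal M (s x) ('D_v s x).

(** The horizontal part of [covd s u v x] is the lift of the covariant derivative
    of the constant vector field [v] along [u].  Moving along [u], the point [s]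
    also moves along the fibre at speed [theta s u], and the horizontal lift of a
    fixed vector turns by [J] along the fibre: this is the term to subtract. *)
HB.lock Definition covd (R : realType) n (M : space_form n) d
    (s : 'rV[R]_d -> Kspace R n) (u v x : 'rV[R]_d) : Kspace R n :=
  der u (hlift M s v) x - theta M s u x *: Jmul M (hlift M s v x).

Section Lift.
Variables (R : realType) (n : nat) (M : space_form n) (d : nat).
Notation K := (Kspace R n).
Notation ip := (@ip R n M).
Notation J := (@Jmul R n M).
Variables (U : set 'rV[R]_d) (s : 'rV[R]_d -> K).
Hypothesis oU : open U.
Hypothesis Cs : smooth_on U s.
Hypothesis Qs : forall x, U x -> ip (s x) (s x) = level R M.
Implicit Types u v x : 'rV[R]_d.

Definition fibre_norm : R := Jsign R M * level R M.

Lemma fibre_norm_neq0 : fibre_norm != 0.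
Proof. by rewrite mulf_neq0 ?Jsign_neq0 ?level_neq0. Qed.

Local Notation theta := (@theta R n M d s).
Local Notation hlift := (@hlift R n M d s).
Local Notation covd := (@covd R n M d s).

Definition gram x : 'M[R]_d := \matrix_(a, b) ip (hlift (e_ R a) x) (hlift (e_ R b) x).

Lemma ip_Js x : U x -> ip (J (s x)) (J (s x)) = fibre_norm.
Proof. by move=> Ux; rewrite ip_JJ Qs. Qed.

Lemma hliftE v x : hlift v x = der v s x - theta v x *: J (s x).
Proof. by rewrite hlift.unlock theta.unlock /horizontal derE. Qed.

Lemma theta_def v x : theta v x = ip (der v s x) (J (s x)) / ip (J (s x)) (J (s x)).
Proof. by rewrite theta.unlock derE. Qed.

Lemma covdE u v x : covd u v x = der u (hlift v) x - theta u x *: J (hlift v x).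
Proof. by rewrite covd.unlock. Qed.

(** [s] takes values in the quadric. *)
Lemma ip_D_s v x : U x -> ip (der v s x) (s x) = 0.
Proof.
move=> Ux; have ds := smooth_derivable (v := v) Cs Ux.
have := der_ip M ds ds.
rewrite (_ : der v _ x = 0); last first.
  rewrite (der_eq_on (g := fun=> level R M) oU _ _ Ux) ?der_cst //.
  by move=> y; rewrite inE; exact: Qs.
by rewrite [ip (s x) _]ip_sym => H; lra.
Qed.

Lemma ip_hlift_s v x : U x -> ip (hlift v x) (s x) = 0.
Proof.
by move=> Ux; rewrite hliftE ipBl ipZl ip_D_s // [ip (J _) _]ip_sym ip_J_self mulr0 subr0.
Qed.

Lemma ip_hlift_Js v x : U x -> ip (hlift v x) (J (s x)) = 0.
Proof.
by move=> Ux; rewrite hliftE ipBl ipZl theta_def divfK ?subrr // ip_Js // fibre_norm_neq0.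
Qed.

Lemma thetaE v : {in U, (fun x => fibre_norm^-1 * ip (der v s x) (J (s x))) =1 theta v}.
Proof. by move=> x; rewrite inE => Ux; rewrite theta_def ip_Js // mulrC. Qed.

Lemma smooth_theta v : smooth_on U (theta v).
Proof.
apply: (smooth_eq oU (@thetaE v)); apply: (smoothM oU); first exact: smooth_cst.
by apply: smooth_ip => //; [exact: smooth_derive|exact: smooth_J].
Qed.

Lemma hlift_fun v : hlift v = (fun x => der v s x - theta v x *: J (s x)).
Proof. by apply/funext => x; exact: hliftE. Qed.

Lemma smooth_hlift v : smooth_on U (hlift v).
Proof.
rewrite hlift_fun; apply: (smoothB oU); first exact: smooth_derive.
by apply: (smoothZ oU); [exact: smooth_theta|exact: smooth_J].
Qed.

Lemma der_hlift u v x : U x -> der u (hlift v) x =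
  der u (der v s) x - (der u (theta v) x *: J (s x) + theta v x *: J (der u s x)).
Proof.
move=> Ux; have dt := smooth_derivable (v := u) (smooth_theta v) Ux.
have ds := smooth_derivable (v := u) Cs Ux.
have dJ := smooth_derivable (v := u) (smooth_J M oU Cs) Ux.
have dZ := smooth_derivable (v := u) (smoothZ oU (smooth_theta v) (smooth_J M oU Cs)) Ux.
have dD := smooth_derivable (v := u) (smooth_derive v Cs) Ux.
have H1 := der_sub dD dZ; rewrite (der_scale dt dJ) (der_J M ds) in H1.
by rewrite hlift_fun.
Qed.

Lemma schwarz_K u v x : U x -> der u (der v s) x = der v (der u s) x.
Proof. by move=> Ux; rewrite !derE; exact: (schwarz u v (fincoords_K R n) oU (Cs 2%N) Ux). Qed.

(** No torsion: modulo [s x] and [J (s x)], which are normal to the horizontal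
    space, [covd u v x] is a second derivative of [s] plus terms that the
    exchange of [u] and [v] permutes. *)
Lemma covd_sym u v x w : U x -> ip w (s x) = 0 -> ip w (J (s x)) = 0 ->
  ip (covd u v x) w = ip (covd v u x) w.
Proof.
move=> Ux ws wJ.
have sym (S0 D Su Sv : K) (a b tu tv : R) :
    ip w S0 = 0 -> ip w (J S0) = 0 ->
    ip w (D - (a *: J S0 + tv *: J Su) - tu *: J (Sv - tv *: J S0)) =
    ip w (D - (b *: J S0 + tu *: J Sv) - tv *: J (Su - tu *: J S0)).
  move=> w0 wJ0; rewrite !(ipBr, ipDr, ipZr, JB, JZ, JJ, ipNr) w0 wJ0; ring.
rewrite (ip_sym M _ w) [RHS](ip_sym M _ w) !covdE (der_hlift u v Ux) (der_hlift v u Ux).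
by rewrite !hliftE (schwarz_K u v Ux); exact: sym.
Qed.

(** The connection is metric: the correction in [covd] disappears because [J] is
    skew. *)
Lemma der_gram u v w x : U x ->
  der u (fun y => ip (hlift v y) (hlift w y)) x =
  ip (covd u v x) (hlift w x) + ip (hlift v x) (covd u w x).
Proof.
move=> Ux; have dv := smooth_derivable (v := u) (smooth_hlift v) Ux.
have dw := smooth_derivable (v := u) (smooth_hlift w) Ux.
rewrite (der_ip M dv dw) !covdE !(ipBl, ipBr, ipZl, ipZr) ip_Jr; ring.
Qed.

Lemma christoffel_gram i j k x : U x ->
  christoffel gram x i j k = \sum_l invmx (gram x) k l *
    ip (covd (e_ R i) (e_ R j) x) (hlift (e_ R l) x).
Proof.
move=> Ux; rewrite /christoffel mulr_sumr; apply: eq_bigr => l _.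
have E a b : (fun y => gram y a b) = (fun y => ip (hlift (e_ R a) y) (hlift (e_ R b) y)).
  by apply/funext => y; rewrite mxE.
have D a b c : 'D_(e_ R a) (fun y => gram y b c) x =
    ip (covd (e_ R a) (e_ R b) x) (hlift (e_ R c) x) +
    ip (hlift (e_ R b) x) (covd (e_ R a) (e_ R c) x).
  by rewrite E -(der_gram _ _ _ Ux) derE.
rewrite !D.
have sy a b c : ip (covd (e_ R a) (e_ R b) x) (hlift (e_ R c) x) =
    ip (covd (e_ R b) (e_ R a) x) (hlift (e_ R c) x).
  by apply: covd_sym => //; [exact: ip_hlift_s|exact: ip_hlift_Js].
rewrite ![ip (hlift _ _) (covd _ _ _)]ip_sym (sy l i j) (sy l j i) (sy j i l).
by field.
Qed.

Lemma gram_sym x : (gram x)^T = gram x.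
Proof. by apply/matrixP => a b; rewrite !mxE ip_sym. Qed.

(** The Koszul formula: by [der_gram] and [covd_sym], [covd] is, after projection,
    the Levi-Civita connection of the Gram matrix. *)
Lemma christoffel_lower i j m x : U x -> gram x \in unitmx ->
  \sum_k christoffel gram x i j k * gram x k m =
  ip (covd (e_ R i) (e_ R j) x) (hlift (e_ R m) x).
Proof.
move=> Ux gU.
pose c : 'cV[R]_d := \col_l ip (covd (e_ R i) (e_ R j) x) (hlift (e_ R l) x).
have E k : christoffel gram x i j k = (invmx (gram x) *m c) k 0.
  by rewrite christoffel_gram // mxE; apply: eq_bigr => l _; rewrite [c _ _]mxE.
rewrite (eq_bigr (fun k => gram x m k * (invmx (gram x) *m c) k 0)); last first.
  move=> k _; rewrite E mulrC; congr (_ * _).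
  by rewrite !mxE ip_sym.
by have := mulKVmx gU c => /matrixP/(_ m 0); rewrite !mxE.
Qed.

(** The curvature of the bundle is a multiple of the form <X, J Y>.  This is where
    the curvature of the space form comes from. *)
Lemma der_theta_antisym u v x : U x ->
  der u (theta v) x - der v (theta u) x = 2 / fibre_norm * ip (der v s x) (J (der u s x)).
Proof.
move=> Ux.
have dth a b : der a (theta b) x = fibre_norm^-1 *
    (ip (der a (der b s) x) (J (s x)) + ip (der b s x) (J (der a s x))).
  rewrite -(der_eq_on oU _ (@thetaE b) Ux).
  have dD := smooth_derivable (v := a) (smooth_derive b Cs) Ux.
  have ds := smooth_derivable (v := a) Cs Ux.
  have dJ := smooth_derivable (v := a) (smooth_J M oU Cs) Ux.
  have di := smooth_derivable (v := a) (smooth_ip M oU (smooth_derive b Cs) (smooth_J M oU Cs)) Ux.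
  rewrite (der_mul (derivable_cst _ _ _) di) der_cst mul0r add0r.
  by rewrite (der_ip M dD dJ) (der_J M ds).
rewrite !dth (schwarz_K u v Ux).
rewrite [ip (der u s x) _]ip_Jr [ip (J (der u s x)) _]ip_sym.
ring.
Qed.

End Lift.

(** * Slices and changes of parameter *)

Lemma unitmx_inj (F : fieldType) d (A : 'M[F]_d) :
  (forall u : 'rV[F]_d, u *m A = 0 -> u = 0) <-> A \in unitmx.
Proof.
split=> [H|AU u uA]; last by rewrite -(mulmxK AU u) uA mul0mx.
rewrite -row_free_unit -kermx_eq0; apply/eqP/row_matrixP => i.
rewrite row0; apply: H; rewrite -row_mul mulmx_ker row0 //.
Qed.

Section LiftLinear.
Variables (R : realType) (n : nat) (M : space_form n) (d : nat).
Notation K := (Kspace R n).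
Notation ip := (@ip R n M).
Notation J := (@Jmul R n M).
Variables (U : set 'rV[R]_d) (s : 'rV[R]_d -> K).
Hypothesis oU : open U.
Hypothesis Cs : smooth_on U s.
Hypothesis Qs : forall x, U x -> ip (s x) (s x) = level R M.
Implicit Types u v x : 'rV[R]_d.

Lemma lift_differentiable x : U x -> differentiable s x.
Proof. by move=> Ux; exact: (C1_differentiable (fincoords_K R n) oU (Cs 1%N) Ux). Qed.

Lemma theta_basis v x : U x -> theta M s v x = \sum_i v 0 i * theta M s (e_ R i) x.
Proof.
move=> Ux; rewrite theta_def derE (derive_basis v (lift_differentiable Ux)).
rewrite ip_suml mulr_suml.
by apply: eq_bigr => i _; rewrite ipZl theta_def derE mulrA.
Qed.

Lemma hlift_basis v x : U x -> hlift M s v x = \sum_i v 0 i *: hlift M s (e_ R i) x.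
Proof.
move=> Ux; rewrite hliftE derE (derive_basis v (lift_differentiable Ux)) (theta_basis _ Ux).
rewrite scaler_suml -sumrB; apply: eq_bigr => i _.
by rewrite hliftE derE scalerBr scalerA.
Qed.

Lemma dot_gram u v x : U x -> dot (gram M s x) u v = ip (hlift M s u x) (hlift M s v x).
Proof.
move=> Ux; rewrite (hlift_basis u Ux) (hlift_basis v Ux) ip_sumr /dot !mxE.
apply: eq_bigr => j _; rewrite ipZr ip_suml mulrC !mxE; congr (_ * _).
by apply: eq_bigr => i _; rewrite ipZl !mxE.
Qed.

End LiftLinear.

Section Slice.
Variables (R : realType) (n : nat) (M : space_form n).
Notation K := (Kspace R n).
Notation ip := (@ip R n M).
Notation J := (@Jmul R n M).
Variables (O : set 'rV[R]_(n.*2)) (s : 'rV[R]_(n.*2) -> K).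
Hypothesis sl : is_slice M O s.

Lemma slice_open : open O. Proof. by case: sl. Qed.
Lemma slice_smooth : smooth_on O s. Proof. by case: sl. Qed.
Lemma slice_quadric x : O x -> ip (s x) (s x) = level R M.
Proof. by case: sl => _ _ Q _ _ Ox; apply: Q; exists x. Qed.

Let oO := slice_open.
Let Cs := slice_smooth.
Let Qs := slice_quadric.

Lemma slice_inj v x : O x -> hlift M s v x = 0 -> v = 0.
Proof.
move=> Ox /eqP; rewrite hliftE derE subr_eq0 => /eqP E.
by case: sl => _ _ _ _; apply; first exact: Ox; exact: E.
Qed.

(** The lifts of the 2n coordinate vectors, together with [s x] and [J (s x)],
    form a basis of the ambient space of dimension 2n + 2. *)
Lemma slice_nondeg w x : O x -> ip w (s x) = 0 -> ip w (J (s x)) = 0 ->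
  (forall i, ip w (hlift M s (e_ R i) x) = 0) -> w = 0.
Proof.
move=> Ox ws wJ wh.
pose X := [tuple hlift M s (e_ R i) x | i < n.*2].
have XE (i : 'I_(n.*2)) : X`_i = hlift M s (e_ R i) x by rewrite -tnth_nth tnth_mktuple.
have fX : free X.
  apply/freeP => k Hk i.
  have : \row_i k i = 0 :> 'rV[R]_(n.*2).
    apply: (@slice_inj _ x Ox); rewrite (hlift_basis _ oO Cs _ Ox) -[RHS]Hk.
    by apply: eq_bigr => j _; rewrite mxE XE.
  by move=> /rowP/(_ i); rewrite !mxE.
have memX y : y \in (X : seq _) -> exists i, y = hlift M s (e_ R i) x.
  by move=> /tnthP[i ->]; exists i; rewrite tnth_mktuple.
have fX1 : free (J (s x) :: X).
  apply: (@free_orth _ _ M) => //.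
    by rewrite (ip_Js Qs Ox) fibre_norm_neq0.
  by move=> y /memX[i ->]; rewrite ip_sym (ip_hlift_Js Qs _ Ox).
have fX2 : free (s x :: J (s x) :: X).
  apply: (@free_orth _ _ M) => //; first by rewrite Qs // level_neq0.
  move=> y; rewrite inE => /orP[/eqP ->|/memX[i ->]]; first exact: ip_J_self.
  by rewrite ip_sym (ip_hlift_s oO Cs Qs _ Ox).
apply: (@free_full_orth R n M (s x :: J (s x) :: X)) => //.
  by rewrite /= size_tuple card_ord -addnn addSn addnS.
move=> y; rewrite !inE => /orP[/eqP -> //|/orP[/eqP -> //|/memX[i ->]]].
exact: wh.
Qed.

Lemma slice_gram_unit x : O x -> gram M s x \in unitmx.
Proof.
move=> Ox; apply/unitmx_inj => u uG.
apply: (@slice_inj _ x Ox); apply: (slice_nondeg Ox).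
- exact: (ip_hlift_s oO Cs Qs _ Ox).
- exact: (ip_hlift_Js Qs _ Ox).
move=> j; rewrite (hlift_basis _ oO Cs _ Ox) ip_suml.
have /rowP/(_ j) := uG; rewrite !mxE => E; rewrite -[RHS]E.
by apply: eq_bigr => i _; rewrite ipZl !mxE.
Qed.

End Slice.

Section Composite.
Variables (R : realType) (n : nat) (M : space_form n) (m d : nat).
Notation K := (Kspace R n).
Notation ip := (@ip R n M).
Notation J := (@Jmul R n M).
Variables (U : set 'rV[R]_m) (O : set 'rV[R]_d) (f : 'rV[R]_m -> 'rV[R]_d).
Variable s : 'rV[R]_d -> K.
Hypothesis oU : open U.
Hypothesis oO : open O.
Hypothesis Cf : smooth_on U f.
Hypothesis fO : f @` U `<=` O.
Hypothesis Cs : smooth_on O s.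

Lemma smooth_comp (W : normedModType R) (g : 'rV[R]_d -> W) : fincoords W -> smooth_on O g ->
  smooth_on U (g \o f).
Proof. by move=> fW Cg k; exact: (Ck_comp fW oU oO fO (Cf k) (Cg k)). Qed.

Lemma chart_im x : U x -> O (f x).
Proof. by move=> Ux; apply: fO; exists x. Qed.

Lemma rep_differentiable x : U x -> differentiable f x.
Proof. by move=> Ux; exact: (C1_differentiable (fincoords_mx R 1 d) oU (Cf 1%N) Ux). Qed.

Lemma derive_smooth_comp (g : 'rV[R]_d -> K) v x : smooth_on O g -> U x ->
  'D_v (g \o f) x = 'D_('D_v f x) g (f x).
Proof.
move=> Cg Ux.
by have [_ ->] := derive_comp v (rep_differentiable Ux)
  (lift_differentiable oO Cg (chart_im Ux)).
Qed.

Lemma theta_comp v x : U x -> theta M (s \o f) v x = theta M s ('D_v f x) (f x).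
Proof. by move=> Ux; rewrite !theta_def !derE (derive_smooth_comp v Cs Ux). Qed.

Lemma hlift_comp v x : U x -> hlift M (s \o f) v x = hlift M s ('D_v f x) (f x).
Proof. by move=> Ux; rewrite !hliftE !derE (theta_comp v Ux) (derive_smooth_comp v Cs Ux). Qed.

End Composite.

(** * The Weingarten and Codazzi equations *)

(** The horizontal lift of a vector field [N] along [f]. *)
HB.lock Definition lift_along (R : realType) n (M : space_form n) m d
    (s : 'rV[R]_d -> Kspace R n) (f N : 'rV[R]_m -> 'rV[R]_d) (x : 'rV[R]_m) :
    Kspace R n :=
  \sum_k N x 0 k *: hlift M s (e_ R k) (f x).

Lemma metric_gram (R : realType) n (M : space_form n) (s : _ -> Kspace R n) :
  metric M s = gram M s.
Proof. by apply/funext => x; apply/matrixP => a b; rewrite !mxE hlift.unlock. Qed.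

Lemma smooth_coord (R : realType) (V : normedModType R) a b (D : set V)
    (g : V -> 'M[R]_(a, b)) i j :
  open D -> smooth_on D g -> smooth_on D (fun x => g x i j).
Proof. by move=> oD Cg k; exact: (Ck_coord _ _ oD (Cg k)). Qed.

Section Weingarten.
Variables (R : realType) (n : nat) (M : space_form n) (m : nat).
Notation K := (Kspace R n).
Notation ip := (@ip R n M).
Notation J := (@Jmul R n M).
Variables (U : set 'rV[R]_m) (O : set 'rV[R]_(n.*2)) (f : 'rV[R]_m -> 'rV[R]_(n.*2)).
Variable s : 'rV[R]_(n.*2) -> K.
Hypothesis oU : open U.
Hypothesis Cf : smooth_on U f.
Hypothesis fO : f @` U `<=` O.
Hypothesis sl : is_slice M O s.
Variable N : 'rV[R]_m -> 'rV[R]_(n.*2).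
Hypothesis CN : smooth_on U N.
Hypothesis Nort : forall x, U x ->
  forall X, dot (gram M s (f x)) (N x) ('D_X f x) = 0.
Variable A : 'rV[R]_m -> 'M[R]_m.
Hypothesis Nshape : forall x X, U x ->
  nabla_along (gram M s) f N x X = - 'D_(X *m A x) f x.

Local Notation tau := (s \o f).
Local Notation Nt := (lift_along M s f N).
Let oO := slice_open sl.
Let Cs := slice_smooth sl.
Let Qs := slice_quadric sl.

Let image_in_slice x : U x -> O (f x). Proof. exact: (chart_im fO). Qed.

Lemma smooth_tau : smooth_on U tau.
Proof. exact: (smooth_comp oU oO Cf fO (fincoords_K R n) Cs). Qed.
Let Ct := smooth_tau.

Lemma quadric_tau x : U x -> ip (tau x) (tau x) = level R M.
Proof. by move=> Ux; exact: (Qs (image_in_slice Ux)). Qed.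
Let Qt := quadric_tau.

Lemma lift_alongE x : Nt x = \sum_k N x 0 k *: hlift M s (e_ R k) (f x).
Proof. by rewrite lift_along.unlock. Qed.

Lemma lift_along_hlift x : U x -> Nt x = hlift M s (N x) (f x).
Proof. by move=> Ux; rewrite lift_alongE (hlift_basis _ oO Cs _ (image_in_slice Ux)). Qed.

Lemma smooth_hlift_comp k : smooth_on U (fun x => hlift M s (e_ R k) (f x)).
Proof.
exact: (smooth_comp oU oO Cf fO (fincoords_K R n) (smooth_hlift oO Cs Qs (e_ R k))).
Qed.

Lemma smooth_normal : smooth_on U Nt.
Proof.
rewrite (_ : Nt = fun x => \sum_k N x 0 k *: hlift M s (e_ R k) (f x)); last first.
  by apply/funext => x; exact: lift_alongE.
apply: (smooth_sum oU) => k; apply: (smoothZ oU).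
  exact: smooth_coord.
exact: smooth_hlift_comp.
Qed.

Lemma normal_orth_tau x : U x -> ip (Nt x) (tau x) = 0.
Proof. by move=> Ux; rewrite lift_along_hlift // (ip_hlift_s oO Cs Qs _ (image_in_slice Ux)). Qed.

Lemma normal_orth_Jtau x : U x -> ip (Nt x) (J (tau x)) = 0.
Proof. by move=> Ux; rewrite lift_along_hlift // (ip_hlift_Js Qs _ (image_in_slice Ux)). Qed.

Lemma normal_orth_tangent x v : U x -> ip (Nt x) (hlift M tau v x) = 0.
Proof.
move=> Ux; rewrite lift_along_hlift // (hlift_comp _ oU oO Cf fO Cs _ Ux).
by rewrite -(dot_gram _ oO Cs _ _ (image_in_slice Ux)) Nort.
Qed.

Lemma normal_orth_dtau x v : U x -> ip (Nt x) (der v tau x) = 0.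
Proof.
move=> Ux; have := normal_orth_tangent v Ux.
by rewrite hliftE ipBr ipZr normal_orth_Jtau // mulr0 subr0.
Qed.

Lemma der_normal v x : U x -> der v Nt x =
  \sum_k der v N x 0 k *: hlift M s (e_ R k) (f x) +
  \sum_k N x 0 k *: \sum_a der v f x 0 a *:
     (covd M s (e_ R a) (e_ R k) (f x) +
      theta M s (e_ R a) (f x) *: J (hlift M s (e_ R k) (f x))).
Proof.
move=> Ux.
rewrite (_ : Nt = fun x => \sum_k N x 0 k *: hlift M s (e_ R k) (f x)); last first.
  by apply/funext => y; exact: lift_alongE.
have dN k := smooth_derivable (v := v) (smooth_coord 0 k oU CN) Ux.
have dh k := smooth_derivable (v := v) (smooth_hlift_comp k) Ux.
have dZ k : derivable (fun y => N y 0 k *: hlift M s (e_ R k) (f y)) x v.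
  exact: (smooth_derivable (v := v) (smoothZ oU (smooth_coord 0 k oU CN) (smooth_hlift_comp k)) Ux).
have [_ ->] := der_sum (index_enum _) dZ.
rewrite -big_split /=; apply: eq_bigr => k _.
rewrite (der_scale (dN k) (dh k)); congr (_ *: _ + _ *: _).
  have [_ E] := is_derive_coord 0 k (smooth_derivable (v := v) CN Ux).
  by rewrite !derE E.
have Ch := smooth_hlift oO Cs Qs (e_ R k).
rewrite derE (derive_smooth_comp oU oO Cf fO v Ch Ux).
rewrite (derive_basis _ (lift_differentiable oO Ch (image_in_slice Ux))) derE.
by apply: eq_bigr => a _; rewrite covdE subrK derE.
Qed.

Lemma shape_coord v x k : U x ->
  der v N x 0 k + \sum_a \sum_b der v f x 0 a * N x 0 b *
    christoffel (gram M s) (f x) a b k = - der (v *m A x) f x 0 k.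
Proof.
move=> Ux; have /rowP/(_ k) := Nshape v Ux.
by rewrite /nabla_along /Gamma !mxE !derE.
Qed.

(** The lift of the covariant derivative of [N] along [v] is the horizontal part of
    [der v Nt x] without its fibre term; the equation of the shape operator
    replaces it by minus the lift of [v *m A x]. *)
Lemma ip_der_normal_slice v x j : U x ->
  ip (der v Nt x) (hlift M s (e_ R j) (f x)) =
  ip (theta M tau v x *: J (Nt x) - hlift M tau (v *m A x) x) (hlift M s (e_ R j) (f x)).
Proof.
move=> Ux.
pose h k := hlift M s (e_ R k) (f x).
pose G a b k := christoffel (gram M s) (f x) a b k.
pose g k := ip (h k) (h j).
have Gg a b : \sum_k G a b k * g k = ip (covd M s (e_ R a) (e_ R b) (f x)) (h j).
  rewrite -(christoffel_lower oO Cs Qs a b j (image_in_slice Ux) (slice_gram_unit sl (image_in_slice Ux))).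
  by apply: eq_bigr => k _; rewrite [gram _ _ _ _ _]mxE.
(* Lower the index k in the equation of the shape operator. *)
have E1 : \sum_k der v N x 0 k * g k = - \sum_k der (v *m A x) f x 0 k * g k -
    \sum_a \sum_b der v f x 0 a * N x 0 b *
      ip (covd M s (e_ R a) (e_ R b) (f x)) (h j).
  rewrite -sumrN.
  have -> : \sum_a \sum_b der v f x 0 a * N x 0 b *
      ip (covd M s (e_ R a) (e_ R b) (f x)) (h j) =
      \sum_k (\sum_a \sum_b der v f x 0 a * N x 0 b * G a b k) * g k.
    under eq_bigr do under eq_bigr do rewrite -Gg mulr_sumr.
    under eq_bigr do rewrite exchange_big /=.
    rewrite exchange_big /=; apply: eq_bigr => k _.
    rewrite mulr_suml; apply: eq_bigr => a _; rewrite mulr_suml.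
    by apply: eq_bigr => b _; rewrite mulrA.
  rewrite -sumrB; apply: eq_bigr => k _.
  by rewrite -mulNr -(shape_coord v k Ux) mulrDl addrK.
have E2 : ip (hlift M tau (v *m A x) x) (h j) = \sum_k der (v *m A x) f x 0 k * g k.
  rewrite (hlift_comp _ oU oO Cf fO Cs _ Ux) (hlift_basis _ oO Cs _ (image_in_slice Ux)) ip_suml.
  by apply: eq_bigr => k _; rewrite ipZl derE.
have E3 : theta M tau v x = \sum_a der v f x 0 a * theta M s (e_ R a) (f x).
  by rewrite (theta_comp _ oU oO Cf fO Cs _ Ux) (theta_basis _ oO Cs _ (image_in_slice Ux)) derE.
rewrite (der_normal v Ux) ipDl ip_suml.
under eq_bigr do rewrite ipZl.
rewrite -/(h j) E1 ipBl ipZl E2 lift_alongE J_sum ip_suml.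
rewrite -addrA addrC; congr (_ - _).
rewrite E3 mulr_suml exchange_big /= ip_suml -sumrN -big_split /=.
under [RHS]eq_bigr do rewrite mulr_sumr.
rewrite [RHS]exchange_big /=; apply: eq_bigr => k _.
rewrite ipZl ip_suml mulr_sumr -sumrN -big_split /=; apply: eq_bigr => a _.
rewrite ipZl ipDl ipZl JZ ipZl.
ring.
Qed.

Lemma ip_der_normal_orth (g : 'rV[R]_m -> K) v x : smooth_on U g ->
  (forall y, U y -> ip (Nt y) (g y) = 0) -> U x ->
  ip (der v Nt x) (g x) = - ip (Nt x) (der v g x).
Proof.
move=> Cg H Ux.
have dN := smooth_derivable (v := v) smooth_normal Ux.
have dg := smooth_derivable (v := v) Cg Ux.
have := der_ip M dN dg.
rewrite (der_eq_on (g := fun=> 0) oU _ _ Ux) ?der_cst; last first.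
  by move=> y; rewrite inE; exact: H.
by move=> /esym/eqP; rewrite addr_eq0 => /eqP.
Qed.

(** The components of both sides agree on the lifts of the coordinate vectors
    ([ip_der_normal_slice]) and on [tau x] and [J (tau x)], to which [Nt] is
    orthogonal, and these vectors form a basis. *)
Lemma weingarten v x : U x -> der v Nt x =
  theta M tau v x *: J (Nt x) - hlift M tau (v *m A x) x
  - ((fibre_norm R M)^-1 * ip (Nt x) (J (der v tau x))) *: J (tau x).
Proof.
move=> Ux; apply/eqP; rewrite -subr_eq0; apply/eqP.
have Et : ip (der v Nt x) (tau x) = 0.
  by rewrite (ip_der_normal_orth v Ct normal_orth_tau Ux) (normal_orth_dtau _ Ux) oppr0.
have EJ : ip (der v Nt x) (J (tau x)) = - ip (Nt x) (J (der v tau x)).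
  rewrite (ip_der_normal_orth v (smooth_J M oU Ct) normal_orth_Jtau Ux).
  by rewrite (der_J M (smooth_derivable (v := v) Ct Ux)).
apply: (slice_nondeg sl (image_in_slice Ux)); rewrite -/(tau x).
- rewrite !(ipBl, ipZl) Et (ip_hlift_s oU Ct Qt _ Ux).
  have -> : ip (J (Nt x)) (tau x) = 0.
    by have := ip_Jr M (Nt x) (tau x); rewrite (normal_orth_Jtau Ux) => /eqP; rewrite eq_sym oppr_eq0 => /eqP.
  have -> : ip (J (tau x)) (tau x) = 0 by rewrite ip_sym ip_J_self.
  ring.
- rewrite !(ipBl, ipZl) EJ (ip_hlift_Js Qt _ Ux) ip_JJ (normal_orth_tau Ux) (ip_Js Qt Ux).
  by field; exact: fibre_norm_neq0.
- move=> j; rewrite ipBl (ip_der_normal_slice v j Ux) [X in _ - X]ipBl ipZl.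
  have -> : ip (J (tau x)) (hlift M s (e_ R j) (f x)) = 0.
    by rewrite ip_sym (ip_hlift_Js Qs _ (image_in_slice Ux)).
  ring.
Qed.

Hypothesis CA : smooth_on U A.

Local Notation eta x j := (ip (hlift M tau (e_ R j) x) (J (Nt x))).

Lemma ip_der_normal_self v x : U x -> ip (der v Nt x) (Nt x) = 0.
Proof.
move=> Ux; rewrite (weingarten v Ux) !(ipBl, ipZl).
rewrite [ip (J (Nt x)) _]ip_sym ip_J_self [ip (hlift _ _ _ _) _]ip_sym (normal_orth_tangent _ Ux).
by rewrite [ip (J (tau x)) _]ip_sym (normal_orth_Jtau Ux); ring.
Qed.

Lemma weingarten_basis i : {in U, (fun y => theta M tau (e_ R i) y *: J (Nt y)
    - \sum_j A y i j *: hlift M tau (e_ R j) y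
    - ((fibre_norm R M)^-1 * ip (Nt y) (J (der (e_ R i) tau y))) *: J (tau y))
  =1 der (e_ R i) Nt}.
Proof.
move=> y; rewrite inE => Uy; rewrite (weingarten _ Uy).
rewrite [hlift M tau (e_ R i *m A y) y](hlift_basis _ oU Ct _ Uy).
by rewrite -rowE; congr (_ - _ - _); apply: eq_bigr => j _; rewrite mxE.
Qed.

(** Differentiate the Weingarten formula.  The vector [J (Nt x)] is orthogonal to
    [J (tau x)], to the [J]-images of the vectors tangent to the hypersurface, and
    to the [J]-image of the derivative of [Nt]; the terms displayed are those that
    survive. *)
Lemma ip_der_der_normal u i x : U x ->
  ip (der u (der (e_ R i) Nt) x) (J (Nt x)) =
  der u (theta M tau (e_ R i)) x * (Jsign R M * ip (Nt x) (Nt x)) -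
  \sum_j (der u A x i j * eta x j +
          A x i j * ip (covd M tau u (e_ R j) x) (J (Nt x))).
Proof.
move=> Ux; rewrite -(der_eq_on oU _ (@weingarten_basis i) Ux).
have CNt := smooth_normal; have CJN := smooth_J M oU CNt.
have Cth := smooth_theta oU Ct Qt (e_ R i).
have Chl j := smooth_hlift oU Ct Qt (e_ R j).
have CJt := smooth_J M oU Ct.
have CAc j := smooth_coord i j oU CA.
have Cb : smooth_on U (fun y => (fibre_norm R M)^-1 * ip (Nt y) (J (der (e_ R i) tau y))).
  apply: (smoothM oU); first exact: smooth_cst.
  apply: (smooth_ip M oU CNt); apply: (smooth_J M oU).
  exact: smooth_derive.
have CS : smooth_on U (fun y => \sum_j A y i j *: hlift M tau (e_ R j) y).
  by apply: (smooth_sum oU) => j; exact: (smoothZ oU (CAc j) (Chl j)).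
have C1 := smoothZ oU Cth CJN.
have C3 := smoothZ oU Cb CJt.
have sd (W : normedModType R) (g : _ -> W) (Cg : smooth_on U g) := smooth_derivable (v := u) Cg Ux.
rewrite (der_sub (sd _ _ (smoothB oU C1 CS)) (sd _ _ C3)).
rewrite (der_sub (sd _ _ C1) (sd _ _ CS)).
rewrite (der_scale (sd _ _ Cth) (sd _ _ CJN)) (der_scale (sd _ _ Cb) (sd _ _ CJt)).
rewrite (der_J M (sd _ _ CNt)) (der_J M (sd _ _ Ct)).
rewrite !(ipDl, ipNl, ipZl) !ip_JJ (ip_der_normal_self _ Ux).
rewrite [ip (der u tau x) _]ip_sym (normal_orth_dtau _ Ux).
rewrite [ip (tau x) _]ip_sym (normal_orth_tau Ux) !mulr0 !addr0 oppr0 addr0.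
congr (_ - _).
have dZ j := sd _ _ (smoothZ oU (CAc j) (Chl j)).
have [_ ->] := der_sum (index_enum _) dZ.
rewrite ip_suml; apply: eq_bigr => j _.
rewrite (der_scale (sd _ _ (CAc j)) (sd _ _ (Chl j))) ipDl !ipZl; congr (_ * _ + _ * _).
  have [_ E] := is_derive_coord i j (sd _ _ CA).
  by rewrite !derE E.
rewrite covdE ipBl ipZl ip_JJ [ip (hlift _ _ _ _) _]ip_sym (normal_orth_tangent _ Ux).
by rewrite !mulr0 subr0.
Qed.

Hypothesis dim_m : m.+1 = n.*2.

Section Point.
Variable x : 'rV[R]_m.
Hypothesis Ux : U x.
Hypothesis gU : gram M tau x \in unitmx.
Hypothesis nu0 : ip (Nt x) (Nt x) != 0.

Local Notation h j := (hlift M tau (e_ R j) x).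
Local Notation G := (gram M tau x).

(** The lifts of the 2n - 1 coordinate vectors of the hypersurface, together with
    the normal, [tau x] and [J (tau x)], form a basis of the ambient space. *)
Lemma hypersurface_nondeg w : ip w (tau x) = 0 -> ip w (J (tau x)) = 0 ->
  ip w (Nt x) = 0 -> (forall i, ip w (h i) = 0) -> w = 0.
Proof.
move=> ws wJ wN wh.
pose X := [tuple h i | i < m].
have XE (i : 'I_m) : X`_i = h i by rewrite -tnth_nth tnth_mktuple.
have fX : free X.
  apply/freeP => k Hk i.
  have : \row_i k i = 0 :> 'rV[R]_m.
    apply: (unitmx_inj _).2 gU _ _; apply/rowP => j; rewrite !mxE.
    transitivity (ip (\sum_(i < m) k i *: X`_i) (h j)); last by rewrite Hk ip0l.
    rewrite ip_suml; apply: eq_bigr => l _.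
    by rewrite !mxE XE ipZl.
  by move=> /rowP/(_ i); rewrite !mxE.
have memX y : y \in (X : seq _) -> exists i, y = h i.
  by move=> /tnthP[i ->]; exists i; rewrite tnth_mktuple.
have fX0 : free (Nt x :: X).
  apply: (@free_orth _ _ M) => //.
  by move=> y /memX[i ->]; rewrite (normal_orth_tangent _ Ux).
have fX1 : free (J (tau x) :: Nt x :: X).
  apply: (@free_orth _ _ M) => //.
    by rewrite (ip_Js Qt Ux) fibre_norm_neq0.
  move=> y; rewrite inE => /orP[/eqP ->|/memX[i ->]].
    by rewrite ip_sym (normal_orth_Jtau Ux).
  by rewrite ip_sym (ip_hlift_Js Qt _ Ux).
have fX2 : free (tau x :: J (tau x) :: Nt x :: X).
  apply: (@free_orth _ _ M) => //; first by rewrite (Qt Ux) level_neq0.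
  move=> y; rewrite !inE => /orP[/eqP ->|/orP[/eqP ->|/memX[i ->]]].
  - exact: ip_J_self.
  - by rewrite ip_sym (normal_orth_tau Ux).
  - by rewrite ip_sym (ip_hlift_s oU Ct Qt _ Ux).
apply: (@free_full_orth R n M (tau x :: J (tau x) :: Nt x :: X)) => //.
  by rewrite /= size_tuple card_ord dim_m -addnn addSn addnS.
move=> y; rewrite !inE => /orP[/eqP -> //|/orP[/eqP -> //|/orP[/eqP -> //|/memX[i ->]]]].
exact: wh.
Qed.

(** [J (Nt x)] is orthogonal to [Nt x], [tau x] and [J (tau x)]. *)
Lemma J_normal_tangent : exists z : 'I_m -> R, J (Nt x) = \sum_k z k *: h k.
Proof.
pose z := (\row_j ip (J (Nt x)) (h j)) *m invmx G.
exists (fun k => z 0 k); apply/eqP; rewrite -subr_eq0; apply/eqP.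
apply: hypersurface_nondeg => [|||i]; rewrite ipBl ip_suml.
- rewrite big1 => [|k _]; last by rewrite ipZl (ip_hlift_s oU Ct Qt _ Ux) mulr0.
  have := ip_Jr M (Nt x) (tau x); rewrite (normal_orth_Jtau Ux) subr0 => /eqP.
  by rewrite eq_sym oppr_eq0 => /eqP.
- rewrite big1 => [|k _]; last by rewrite ipZl (ip_hlift_Js Qt _ Ux) mulr0.
  by rewrite ip_JJ (normal_orth_tau Ux) mulr0 subr0.
- rewrite big1 => [|k _]; last by rewrite ipZl ip_sym (normal_orth_tangent _ Ux) mulr0.
  by rewrite ip_sym ip_J_self subr0.
have := mulmxKV gU (\row_j ip (J (Nt x)) (h j)).
move=> /rowP/(_ i); rewrite [RHS]mxE => <-; rewrite -/z mxE.
apply/eqP; rewrite subr_eq0; apply/eqP; apply: eq_bigr => k _.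
by rewrite ipZl [gram _ _ _ _ _]mxE.
Qed.

Lemma ip_covd_J_normal k j : ip (covd M tau (e_ R k) (e_ R j) x) (J (Nt x)) =
  \sum_l christoffel (gram M tau) x k j l * eta x l.
Proof.
have [z Ez] := J_normal_tangent; rewrite Ez ip_sumr.
under eq_bigr do rewrite ipZr -(christoffel_lower oU Ct Qt _ _ _ Ux gU) mulr_sumr.
rewrite exchange_big /=; apply: eq_bigr => l _.
rewrite ip_sumr mulr_sumr; apply: eq_bigr => p _.
by rewrite ipZr mulrCA [gram _ _ _ _ _]mxE.
Qed.

(** The pairing with [J (Nt x)] of the derivative along e_k of the vector field
    A e_i.  It differs from that of (nabla_k A) e_i by the pairing of
    A (nabla_k e_i), which is symmetric in [i] and [k]. *)
Definition lowered_dshape k i : R :=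
  \sum_l (der (e_ R k) A x i l +
          \sum_j A x i j * christoffel (gram M tau) x k j l) * eta x l.

Local Notation om i k := (ip (der (e_ R i) tau x) (J (der (e_ R k) tau x))).

(** Second derivatives of [Nt] commute, so that antisymmetrizing
    [ip_der_der_normal] leaves the exterior derivative of [theta]. *)
Lemma codazzi i k : 2 / fibre_norm R M * om i k * (Jsign R M * ip (Nt x) (Nt x)) =
  lowered_dshape k i - lowered_dshape i k.
Proof.
have sym := schwarz_K oU smooth_normal (e_ R k) (e_ R i) Ux.
have E a b : lowered_dshape a b =
    der (e_ R a) (theta M tau (e_ R b)) x * (Jsign R M * ip (Nt x) (Nt x)) -
    ip (der (e_ R a) (der (e_ R b) Nt) x) (J (Nt x)).
  rewrite (ip_der_der_normal _ _ Ux) subKr /lowered_dshape.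
  under [LHS]eq_bigr do rewrite mulrDl.
  rewrite [LHS]big_split [RHS]big_split /=; congr (_ + _).
  under [RHS]eq_bigr do rewrite ip_covd_J_normal mulr_sumr.
  rewrite exchange_big /=; apply: eq_bigr => l _.
  by rewrite mulr_suml; apply: eq_bigr => j _; rewrite mulrA.
by rewrite !E sym -(der_theta_antisym oU Ct Qt _ _ Ux); ring.
Qed.

Lemma ip_dtau_J_dtau i k : om i k = ip (h i) (J (h k)).
Proof.
have E j : der (e_ R j) tau x = h j + theta M tau (e_ R j) x *: J (tau x).
  by rewrite hliftE subrK.
rewrite !E JD JZ JJ !(ipDl, ipDr, ipZl, ipZr, ipNr) !ip_JJ.
rewrite (ip_hlift_s oU Ct Qt _ Ux) [ip (tau x) _]ip_sym (ip_hlift_s oU Ct Qt _ Ux).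
by rewrite [ip (J (tau x)) (tau x)]ip_sym ip_J_self; ring.
Qed.

(** If the form <X, J Y> on the hypersurface were [al] /\ [eta], with [eta] the
    pairing with [J (Nt x)], then contraction with the tangent vector [J (Nt x)],
    in the kernel of the form, would make [al] a multiple of [eta] and the form
    zero.  [J] would then send every tangent vector to a multiple of [Nt x], and
    the induced metric would have rank at most one. *)
Lemma codazzi_indecomposable (al : 'I_m -> R) : (1 < m)%N ->
  (forall i k, lowered_dshape k i - lowered_dshape i k = al k * eta x i - al i * eta x k) ->
  False.
Proof.
move=> m1 H.
have [z Ez] := J_normal_tangent.
pose nu := ip (Nt x) (Nt x).
have e0 := Jsign_neq0 R M.
have enu : Jsign R M * nu != 0 by rewrite mulf_neq0.
have E i k : 2 / fibre_norm R M * ip (h i) (J (h k)) * (Jsign R M * nu) =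
    al k * eta x i - al i * eta x k by rewrite -ip_dtau_J_dtau codazzi.
have zom i : \sum_k z k * ip (h i) (J (h k)) = 0.
  transitivity (ip (h i) (J (J (Nt x)))).
    rewrite Ez J_sum ip_sumr; apply: eq_bigr => k _.
    by rewrite JZ ipZr.
  by rewrite JJ ipNr ipZr ip_sym (normal_orth_tangent _ Ux) mulr0 oppr0.
have zeta : \sum_k z k * eta x k = Jsign R M * nu.
  rewrite -[RHS]ip_JJ [X in _ = ip X _]Ez ip_suml; apply: eq_bigr => k _.
  by rewrite ipZl.
pose az := \sum_k z k * al k.
have ale i : al i * (Jsign R M * nu) = az * eta x i.
  apply/eqP; rewrite eq_sym -subr_eq0; apply/eqP.
  transitivity (2 / fibre_norm R M * (\sum_k z k * ip (h i) (J (h k))) * (Jsign R M * nu)).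
    rewrite -{1}zeta /az mulr_suml mulr_sumr -sumrB mulr_sumr mulr_suml.
    apply: eq_bigr => k _; rewrite -[RHS]mulrA [RHS]mulrCA -mulrA [RHS]mulrC.
    rewrite -mulrA.
    have := E i k; set t := ip _ (J (h k)); rewrite -/nu => Et.
    transitivity (z k * (al k * eta x i - al i * eta x k)); first by ring.
    by rewrite -Et; ring.
  by rewrite zom mulr0 mul0r.
have om0 i k : ip (h i) (J (h k)) = 0.
  have EE : (al k * eta x i - al i * eta x k) * (Jsign R M * nu) = 0.
    rewrite mulrBl mulrAC ale [X in _ - X]mulrAC ale; ring.
  move/eqP: EE; rewrite -E mulf_eq0 (negPf enu) orbF mulf_eq0 (negPf enu) orbF.
  rewrite mulf_eq0 => /orP[|/eqP //].
  by rewrite mulf_eq0 invr_eq0 (negPf (fibre_norm_neq0 R M)) orbF pnatr_eq0.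
have Jh k : J (h k) = (ip (J (h k)) (Nt x) / nu) *: Nt x.
  apply/eqP; rewrite -subr_eq0; apply/eqP; apply: hypersurface_nondeg => [|||i]; rewrite ipBl ipZl.
  - rewrite (normal_orth_tau Ux) mulr0 subr0.
    have := ip_Jr M (h k) (tau x); rewrite (ip_hlift_Js Qt _ Ux) => /eqP.
    by rewrite eq_sym oppr_eq0 => /eqP.
  - by rewrite ip_JJ (ip_hlift_s oU Ct Qt _ Ux) (normal_orth_Jtau Ux) !mulr0 subr0.
  - by rewrite divfK ?subrr.
  - by rewrite [ip (J _) _]ip_sym om0 (normal_orth_tangent _ Ux) mulr0 subr0.
pose c : 'rV[R]_m := \row_k (ip (J (h k)) (Nt x) / nu).
have Gc : G = (Jsign R M * nu) *: (c^T *m c).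
  apply/matrixP => i k; rewrite !mxE big_ord1 !mxE.
  rewrite -[LHS]mul1r -(Jsign_sqr R M) -mulrA -ip_JJ.
  have -> : ip (J (h i)) (J (h k)) = ip ((ip (J (h i)) (Nt x) / nu) *: Nt x)
      ((ip (J (h k)) (Nt x) / nu) *: Nt x) by rewrite -!Jh.
  by rewrite ipZl ipZr -/nu; ring.
have : (\rank G <= 1)%N.
  by rewrite Gc; apply: leq_trans (mxrank_scale _ _) _; apply: leq_trans (mxrankM_maxr _ _) (rank_leq_row _).
by move: gU; rewrite -row_free_unit /row_free => /eqP ->; rewrite leqNgt m1.
Qed.

End Point.
End Weingarten.

(** * Christoffel symbols and the two conditions *)

Section Connection.
Variables (R : realType) (d : nat).
Implicit Types (g : 'rV[R]_d -> 'M[R]_d) (U : set 'rV[R]_d).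

Lemma christoffel_eq_on U g g' x i j k : open U -> {in U, g =1 g'} -> U x ->
  christoffel g x i j k = christoffel g' x i j k.
Proof.
move=> oU gg' Ux; rewrite /christoffel gg' ?inE //; congr (_ * _).
have E v a b : 'D_v (fun y => g y a b) x = 'D_v (fun y => g' y a b) x.
  by apply: (derive_eq_on v oU _ Ux) => y Uy; rewrite gg'.
by apply: eq_bigr => l _; rewrite !E.
Qed.

Lemma christoffel_sym g x i j k : (forall y, (g y)^T = g y) ->
  christoffel g x i j k = christoffel g x j i k.
Proof.
move=> gs; rewrite /christoffel; congr (_ * _); apply: eq_bigr => l _.
have -> : (fun y => g y i j) = (fun y => g y j i).
  by apply/funext => y; rewrite -[in LHS]gs mxE.
by congr (_ * (_ - _)); rewrite addrC.
Qed.

Lemma nabla_const g x k i p :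
  nabla g (fun=> e_ R k) (fun=> e_ R i) x 0 p = christoffel g x k i p.
Proof.
rewrite /nabla /nabla_along derive_cst add0r derive_id mxE.
rewrite (bigD1 k) //= [X in _ + X]big1 => [|a ak].
  rewrite (bigD1 i) //= big1 => [|b bi]; last by rewrite !mxE (negPf bi) andbF mulr0 mul0r.
  by rewrite !mxE !eqxx !mul1r !addr0.
by apply: big1 => b _; rewrite !mxE (negPf ak) andbF !mul0r.
Qed.

Lemma nabla_row g (A : 'rV[R]_d -> 'M[R]_d) x k i p :
  derivable A x (e_ R k) ->
  nabla g (fun=> e_ R k) (fun y => e_ R i *m A y) x 0 p =
  der (e_ R k) A x i p + \sum_j A x i j * christoffel g x k j p.
Proof.
move=> dA; rewrite /nabla /nabla_along derive_id [LHS]mxE; congr (_ + _).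
  rewrite derE.
  have dAc a b := is_derive_coord a b dA.
  have -> : (fun y => e_ R i *m A y) = (fun y => \row_j A y i j).
    by apply/funext => y; rewrite -rowE; apply/rowP => j; rewrite !mxE.
  rewrite derive_mx; last first.
    apply/derivable_mxP => a b.
    rewrite (_ : (fun y => _) = (fun y => A y i b)); first by case: (dAc i b).
    by apply/funext => y; rewrite mxE.
  rewrite mxE (_ : (fun y => _) = (fun y => A y i p)); first by case: (dAc i p).
  by apply/funext => y; rewrite mxE.
rewrite mxE (bigD1 k) //= [X in _ + X]big1 => [|a ak].
  rewrite addr0; apply: eq_bigr => j _.
  by rewrite -rowE !mxE !eqxx !mul1r.
by apply: big1 => b _; rewrite !mxE (negPf ak) andbF !mul0r.
Qed.

End Connection.

Section PatchLevel.
Variables (R : realType) (n : nat) (M : space_form n) (S : hypersurface R M).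
Variable P : patch M (@imm _ _ _ S).
Notation ip := (@ip R n M).

Let oU := @patch_open _ _ _ _ _ P.
Let Cf := @patch_smooth _ _ _ _ _ P.
Let fO := @patch_sub _ _ _ _ _ P.
Let sl := @patch_slice _ _ _ _ _ P.
Local Notation tau := (sigma P \o rep P).

Lemma induced_gram : {in dom P, induced P =1 gram M tau}.
Proof.
move=> x; rewrite inE => Ux; apply/matrixP => a b; rewrite !mxE.
have oO := slice_open sl; have Cs := slice_smooth sl.
rewrite /ambient metric_gram (dot_gram _ oO Cs _ _ (chart_im fO Ux)).
by rewrite !(hlift_comp _ oU oO Cf fO Cs _ Ux).
Qed.

Lemma christoffel_induced x i j k : dom P x ->
  christoffel (induced P) x i j k = christoffel (gram M tau) x i j k.
Proof. by move=> Ux; exact: (christoffel_eq_on _ _ _ oU induced_gram Ux). Qed.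

Variables (N : 'rV[R]_((n.*2).-1) -> 'rV[R]_(n.*2)) (A : 'rV[R]_((n.*2).-1) -> 'M[R]_((n.*2).-1)).
Hypothesis hn : (2 <= n)%N.
Hypothesis nd : nondegenerate S.
Hypothesis HN : unit_normal P N.
Hypothesis HA : shape_operator P N A.

Local Notation eta x j :=
  (ip (hlift M tau (e_ R j) x) (Jmul M (lift_along M (sigma P) (rep P) N x))).
Local Notation cs := (lowered_dshape M (rep P) (sigma P) N A).

(** The form in which both conditions are refuted: [al] is 0 for a parallel shape
    operator, and the differential of [lambda] for an umbilic hypersurface. *)
Lemma dshape_indecomposable x (al : 'I_(n.*2).-1 -> R) : dom P x ->
  (forall i k, cs x k i - cs x i k = al k * eta x i - al i * eta x k) -> False.
Proof.
move=> Ux H; case: HN => CN HNn; case: HA => CA HAs.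
have n0 : (0 < n)%N by apply: leq_trans hn.
have Nort y : dom P y -> forall X, dot (gram M (sigma P) (rep P y)) (N y) ('D_X (rep P) y) = 0.
  by move=> Uy X; rewrite -metric_gram; have [_] := HNn y Uy; apply.
have Nsh y X : dom P y ->
    nabla_along (gram M (sigma P)) (rep P) N y X = - 'D_(X *m A y) (rep P) y.
  by move=> Uy; rewrite -metric_gram; apply: HAs.
have dimm : (n.*2).-1.+1 = n.*2 by rewrite prednK // double_gt0.
have gU : gram M tau x \in unitmx by rewrite -induced_gram ?inE //; apply: nd.
have nu0 : ip (lift_along M (sigma P) (rep P) N x) (lift_along M (sigma P) (rep P) N x) != 0.
  rewrite (lift_along_hlift fO sl N Ux) -(dot_gram _ (slice_open sl) (slice_smooth sl) _ _ (chart_im fO Ux)).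
  rewrite -metric_gram; have [[->|->] _] := HNn x Ux; by rewrite ?oppr_eq0 oner_eq0.
apply: (codazzi_indecomposable oU Cf fO sl CN Nort Nsh CA dimm Ux gU nu0 _ H).
by rewrite -ltnS dimm; apply: leq_trans (_ : 2.*2 <= _)%N; rewrite ?leq_double.
Qed.

Lemma umbilic_patch_absurd (lambda : 'rV[R]_((n.*2).-1) -> R) x : dom P x ->
  smooth_on (dom P) lambda ->
  (forall x, dom P x -> A x = (lambda x)%:M) -> False.
Proof.
move=> Ux Cl Al.
apply: (dshape_indecomposable (al := fun k => der (e_ R k) lambda x) Ux) => i k.
have E a b : cs x a b = der (e_ R a) lambda x * eta x b +
    lambda x * \sum_l christoffel (gram M tau) x a b l * eta x l.
  rewrite /lowered_dshape.
  have dA l : der (e_ R a) A x b l = der (e_ R a) lambda x *+ (b == l).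
    case: HA => CA _.
    have [_ El] := is_derive_coord b l (smooth_derivable (v := e_ R a) CA Ux).
    have dl := smooth_derivable (v := e_ R a) Cl Ux.
    rewrite !derE -El -(derive_eq_on (f := fun y => (b == l)%:R * lambda y) _ oU _ Ux).
      by have := deriveZ (b == l)%:R dl => ->; rewrite scaler_nat.
    by move=> y; rewrite inE => Uy; rewrite (Al y Uy) mxE mulr_natl.
  under eq_bigr do rewrite mulrDl.
  rewrite big_split /=; congr (_ + _).
    rewrite (bigD1 b) //= dA eqxx mulr1n big1 ?addr0 // => l lb.
    by rewrite dA eq_sym (negPf lb) mulr0n mul0r.
  rewrite mulr_sumr; apply: eq_bigr => l _.
  rewrite mulrA; congr (_ * _); rewrite (bigD1 b) //= (Al x Ux) mxE eqxx mulr1n.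
  rewrite big1 ?addr0 // => j jb.
  by rewrite mxE eq_sym (negPf jb) mulr0n mul0r.
have sy l : christoffel (gram M tau) x k i l = christoffel (gram M tau) x i k l.
  by apply: christoffel_sym => y; exact: gram_sym.
rewrite !E; under eq_bigr do rewrite sy.
by rewrite opprD addrACA subrr addr0.
Qed.

(** Applied to constant fields, the hypothesis makes [lowered_dshape] equal to the
    pairing of A (nabla_k e_i), which is symmetric in [i] and [k]. *)
Lemma parallel_patch_absurd x : dom P x ->
  (forall X Y, smooth_on (dom P) X -> smooth_on (dom P) Y ->
     forall x, dom P x ->
       nabla (induced P) X (fun y => Y y *m A y) x =
       nabla (induced P) X Y x *m A x) -> False.
Proof.
move=> Ux HP.
apply: (dshape_indecomposable (al := fun=> 0) Ux) => i k.
have CA := HA.1.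
have E a b : cs x a b = \sum_l (\sum_p christoffel (gram M tau) x a b p * A x p l) * eta x l.
  apply: eq_bigr => l _; congr (_ * _).
  have /rowP/(_ l) := HP _ _ (@smooth_cst _ _ _ (dom P) (e_ R a))
    (@smooth_cst _ _ _ (dom P) (e_ R b)) x Ux.
  rewrite (nabla_row _ _ _ (smooth_derivable CA Ux)) mxE.
  under eq_bigr do rewrite (christoffel_induced _ _ _ Ux).
  by under [RHS]eq_bigr do rewrite nabla_const (christoffel_induced _ _ _ Ux).
rewrite !mul0r subrr !E; apply/eqP; rewrite subr_eq0; apply/eqP.
apply: eq_bigr => l _; congr (_ * _); apply: eq_bigr => p _; congr (_ * _).
by apply: christoffel_sym => y; exact: gram_sym.
Qed.

End PatchLevel.

Theorem theorem1 (R : realType) (n : nat) (hn : (2 <= n)%N) (M : space_form n)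
    (hM : @quadric R n M !=set0) :
  (~ exists S : hypersurface R M, nondegenerate S /\ umbilic S) /\
  (~ exists S : hypersurface R M, nondegenerate S /\ parallel_shape S).
Proof.
split=> -[S [nd HS]]; have [p _] := manifold_nonempty S.
- have [P [N [A [[x Ux _] HN HA [lambda Cl Al]]]]] := HS p.
  exact: (umbilic_patch_absurd hn nd HN HA Ux Cl Al).
- have [P [N [A [[x Ux _] HN HA HP]]]] := HS p.
  exact: (parallel_patch_absurd hn nd HN HA Ux HP).
Qed.
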